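(* Let $x_k$ be the iterates of the relaxed randomized Kaczmarz iteration described in the context, with learning rate $\alpha_k$ defined, for a given parameter $\eta$, by $\beta_0:=\|x-x_0\|^2/\sigma^2$ and $$\alpha_k=\frac{\eta\beta_k}{\eta\beta_k+1},\qquad \beta_{k+1}=\beta_k(1-\eta\alpha_k),\qquad k=0,1,\dots.\qquad(\ast)$$ Assume that, for each iteration $k$, $$\mathbb{E}_{i_0,\ldots,i_{k-1}}\left|\left\langle\frac{x_k-x}{\|x-x_k\|},\frac{a_{i_k}}{\|a_{i_k}\|}\right\rangle\right|^2=\eta.\qquad(\ast\ast)$$ Then $$\mathbb{E}\|x-x_k\|^2=\sigma^2\beta_k,$$ and the learning rate $\alpha_k$ defined by $(\ast)$ is optimal in the sense that it minimizes the expected error $\mathbb{E}\|x-x_k\|^2$ over all possible choices of scheduled learning rates (learning rates that only depend on the iteration number $k$ and possibly hyperparameters). Moreover, in the case where $A$ is a random matrix with i.i.d. rows used in order (see the context), if $$\mathbb{E}\left|\left\langle z,\frac{a}{\|a\|}\right\rangle\right|^2\ge\eta\|z\|^2\quad\text{for all } z\in\mathbb{R}^n$$ holds with $\eta=1/n$, where $a$ is a random vector with the common distribution of the rows and the expectation is over $a$, then $(\ast\ast)$ holds (with $\eta=1/n$), and hence the learning rate $(\ast)$ is optimal.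
   Context: $A$ is an $m\times n$ matrix with rows $a_i$, $Ax=b$ is a consistent linear system with solution $x$, and $\tilde b=b+\varepsilon$, where $\varepsilon=(\varepsilon_1,\dots,\varepsilon_m)$ has independent entries such that $\varepsilon_i$ has mean $0$ and variance $\sigma^2\|a_i\|^2$. Given a starting vector $x_0$, the relaxed randomized Kaczmarz iteration with learning rate $\alpha_k$ is $$x_{k+1}=x_k+\alpha_k\,\frac{\tilde b_{i_k}-\langle a_{i_k},x_k\rangle}{\|a_{i_k}\|^2}\,a_{i_k},$$ where the row index $i_k$ is chosen without replacement, from $\{1,\dots,m\}\setminus\{i_0,\dots,i_{k-1}\}$, with probability proportional to $\|a_{i_k}\|^2$ (so there are at most $m$ iterations). In the i.i.d. case, $A$ is instead an $m\times n$ random matrix with i.i.d. rows, and the iteration is run with the rows taken in order, $i_k=k$. $\mathbb{E}_{i_0,\ldots,i_{k-1}}$ denotes expectation conditional on $\{i_0,\dots,i_{k-1}\}$, $\mathbb{E}$ denotes the full expectation, and $\|\cdot\|$ and $\langle\cdot,\cdot\rangle$ are the $\ell^2$ norm and inner product.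
   Formalization: In the first part, optimality is over schedules whose own iterates also satisfy ( ** ) at the earlier steps (it fails if ( ** ) holds only along ( * )), and the expectation in ( ** ) is conditional on the past rows and noise as well as the indices, on the event that x_k differs from x. *)

(* Defs.v *)
From HB Require Import structures.
From mathcomp Require Import all_boot all_order all_algebra.
From mathcomp Require Import all_classical all_reals all_analysis.

Set Implicit Arguments.
Unset Strict Implicit.
Unset Printing Implicit Defensive.

Import Order.TTheory GRing.Theory Num.Theory.
Import numFieldNormedType.Exports.

Local Open Scope classical_set_scope.
Local Open Scope ring_scope.

(* The library norm on matrices is the sup norm, so the Euclidean structure is
   introduced here. *)
Definition dot (R : realType) (n : nat) (u v : 'cV[R]_n) : R :=
  \sum_(j < n) u j 0 * v j 0.

Definition l2norm (R : realType) (n : nat) (u : 'cV[R]_n) : R :=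
  Num.sqrt (dot u u).

(* u / ||u||, with value 0 at u = 0. *)
Definition normalize (R : realType) (n : nat) (u : 'cV[R]_n) : 'cV[R]_n :=
  (l2norm u)^-1 *: u.

(* The i-th row a_i of A, as a vector of R^n. *)
Definition arow (R : realType) (m n : nat) (A : 'M[R]_(m, n)) (i : 'I_m) :
  'cV[R]_n := (row i A)^T.

(* The same row as a tuple: tuples, unlike matrices, carry the (product) Borel
   sigma-algebra in the library. *)
Definition row_tuple (R : realType) (m n : nat) (A : 'M[R]_(m, n)) (i : 'I_m) :
  n.-tuple R := [tuple A i j | j < n].

Fixpoint opt_beta (R : realType) (eta beta0 : R) (k : nat) : R :=
  if k is k'.+1 then
    let beta := opt_beta eta beta0 k' in
    beta * (1 - eta * (eta * beta / (eta * beta + 1)))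
  else beta0.

Definition opt_alpha (R : realType) (eta beta0 : R) (k : nat) : R :=
  eta * opt_beta eta beta0 k / (eta * opt_beta eta beta0 k + 1).

Section Kaczmarz.
Context {R : realType} {d : measure_display} {T : measurableType d}.
Variables (P : probability T R) (m n : nat).

(* A deterministic matrix is a constant function A.  The index idx k is the row
   used at step k; only the indices with k < m are meaningful. *)
Variables (A : T -> 'M[R]_(m, n)) (b : T -> 'cV[R]_m)
  (eps : 'I_m -> {RV P >-> R}) (idx : nat -> T -> 'I_m).

Definition noisy_rhs (w : T) : 'cV[R]_m := \col_i (b w i 0 + eps i w).

Fixpoint iterate (alpha : nat -> R) (x0 : 'cV[R]_n) (k : nat) (w : T) :
    'cV[R]_n :=
  if k is k'.+1 then
    let xk := iterate alpha x0 k' w in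
    let i := idx k' w in
    let a := arow (A w) i in
    xk + (alpha k' * ((noisy_rhs w i 0 - dot a xk) / l2norm a ^+ 2)) *: a
  else x0.

Definition expected_error (x x0 : 'cV[R]_n) (alpha : nat -> R) (k : nat) :
    \bar R :=
  'E_P[fun w => l2norm (x - iterate alpha x0 k w) ^+ 2].

(* The events known before step k: the sigma-algebra generated by the indices,
   the rows and the noise entries used at the steps j < k. *)
Definition history (k : nat) : set (set T) :=
  <<s [set S | exists2 j, (j < k)%N &
        (exists i, S = idx j @^-1` [set i]) \/
        (exists2 B : set (n.-tuple R * R), measurable B &
          S = (fun w => (row_tuple (A w) (idx j w), eps (idx j w) w)) @^-1` B)]
  >>.

(* E[V | G] = c almost surely on the event D, for V >= 0 and D in G. *)
Definition cond_expectation_on (G : set (set T)) (D : set T) (V : T -> R)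
    (c : R) : Prop :=
  forall S, G S -> S `<=` D -> (\int[P]_(w in S) (V w)%:E = c%:E * P S)%E.

(* The expected squared cosine between the error x_k - x and the row used at
   step k, given the past, is eta; the direction of the error only makes sense
   where x_k <> x.  Through x_k this is a condition on the schedule alpha. *)
Definition alignment (x x0 : 'cV[R]_n) (eta : R) (alpha : nat -> R) (k : nat) :
    Prop :=
  cond_expectation_on (history k) [set w | iterate alpha x0 k w != x]
    (fun w => `|dot (normalize (iterate alpha x0 k w - x))
                    (normalize (arow (A w) (idx k w)))| ^+ 2)
    eta.

Definition mutually_independent {d'} {Y : measurableType d'} (I : finType)
    (Z : I -> T -> Y) : Prop :=
  forall (J : {set I}) (B : I -> set Y), (forall i, measurable (B i)) ->
    P (\bigcap_(i in [set i | i \in J]) Z i @^-1` B i)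
    = (\prod_(i in J) P (Z i @^-1` B i))%E.

Definition path_event (h : nat -> 'I_m) (k : nat) : set T :=
  [set w | forall j, (j < k)%N -> idx j w = h j].

(* The probability that step k uses row i when the steps j < k used the rows h j. *)
Definition weight_without_replacement (A0 : 'M[R]_(m, n)) (h : nat -> 'I_m)
    (k : nat) (i : 'I_m) : R :=
  let used := [set h (val j) | j : 'I_k]%SET in
  if i \in used then 0
  else l2norm (arow A0 i) ^+ 2
       / \sum_(l | l \notin used) l2norm (arow A0 l) ^+ 2.

Record without_replacement_model (sigma : R) (A0 : 'M[R]_(m, n)) : Prop := {
  wr_matrix : forall w, A w = A0;
  wr_rows_neq0 : forall i, arow A0 i != 0;
  wr_idx_measurable : forall k i, (k < m)%N -> measurable (idx k @^-1` [set i]);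
  wr_idx_law : forall (h : nat -> 'I_m) k i, (k < m)%N ->
    P (path_event h k `&` idx k @^-1` [set i])
    = (P (path_event h k) * (weight_without_replacement A0 h k i)%:E)%E;
  wr_noise_independent : mutually_independent (fun i => eps i : T -> R);
  wr_noise_mean : forall i, ('E_P[eps i] = 0)%E;
  wr_noise_variance : forall i,
    ('V_P[eps i] = (sigma ^+ 2 * l2norm (arow A0 i) ^+ 2)%R%:E)%E;
  wr_idx_noise_independent :
    forall (h : nat -> 'I_m) (B : set (m.-tuple R)), measurable B ->
    let N := [set w | B [tuple eps i w | i < m]] in
    P (path_event h m `&` N) = (P (path_event h m) * P N)%E
}.

(* Given a_i, the noise eps_i has mean 0 and variance sigma^2 ||a_i||^2.  As
   ||a_i|| need not be square integrable, the conditional mean is tested only on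
   the sigma(a_i)-events where eps_i is integrable; by the variance condition
   these include all the events { ||a_i|| <= r }. *)
Record iid_rows_model (sigma : R) : Prop := {
  iid_in_order : forall k w, (k < m)%N -> idx k w = k :> nat;
  iid_matrix_measurable : forall i j, measurable_fun setT (fun w => A w i j);
  iid_rows_neq0 : forall i, P [set w | arow (A w) i = 0] = 0%E;
  iid_rows_law : forall i i' (B : set (n.-tuple R)), measurable B ->
    P [set w | B (row_tuple (A w) i)] = P [set w | B (row_tuple (A w) i')];
  iid_independent : mutually_independent
    (fun i w => (row_tuple (A w) i, eps i w));
  iid_noise_mean : forall i (B : set (n.-tuple R)), measurable B ->
    let S := [set w | B (row_tuple (A w) i)] in
    P.-integrable S (fun w => (eps i w)%:E) ->
    (\int[P]_(w in S) (eps i w)%:E = 0)%E;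
  iid_noise_variance : forall i (B : set (n.-tuple R)), measurable B ->
    let S := [set w | B (row_tuple (A w) i)] in
    (\int[P]_(w in S) (eps i w ^+ 2)%R%:E
     = \int[P]_(w in S) (sigma ^+ 2 * l2norm (arow (A w) i) ^+ 2)%R%:E)%E
}.

End Kaczmarz.

(* Main.v *)
Require Import Defs.
From HB Require Import structures.
From mathcomp Require Import all_boot all_order all_algebra.
From mathcomp Require Import all_classical all_reals all_analysis.
From mathcomp Require Import measurable_realfun lebesgue_measure.
From mathcomp Require Import ring lra.

Set Implicit Arguments.
Unset Strict Implicit.
Unset Printing Implicit Defensive.

Import Order.TTheory GRing.Theory Num.Theory.
Import numFieldNormedType.Exports.

Local Open Scope classical_set_scope.
Local Open Scope ring_scope.

(* With e_k = x_k - x and a the row used at step k, expanding the square gives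
     |e_(k+1)|^2 = |e_k|^2 - (2 alpha - alpha^2) <a, e_k>^2 / |a|^2
       + 2 alpha (1 - alpha) eps <a, e_k> / |a|^2 + alpha^2 eps^2 / |a|^2 .
   The alignment condition turns the mean of the second term into
   eta E|e_k|^2, the third has mean zero because the noise is centred and
   independent of the past, and the last has mean alpha^2 sigma^2.  Hence
   E|e_k|^2 / sigma^2 obeys
     f |-> f - (2 alpha - alpha^2) eta f + alpha^2,
   which is minimal in alpha exactly at eta f / (eta f + 1), with value
   f (1 - eta alpha), and is nondecreasing in f since 0 <= eta <= 1: stepwise
   optimality is therefore global optimality.
   If the rows are i.i.d. and E<z, a/|a|>^2 >= |z|^2 / n for all z, then the
   symmetric matrix E[a a^T / |a|^2] - I / n is positive semidefinite with
   trace 0, hence zero, and alignment follows as a is independent of e_k. *)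

(** When rows are drawn without replacement, the row met at step [k] depends on the past, so the
    pair formed by that row and its noise is not independent of the history. What survives is
    independence given the whole visiting order: on the event that the order is [h], the observation
    of row [h k] is independent of the history before step [k]. Summing over the finitely many
    orders then annihilates, on every history event, each function of the fresh observation whose
    mean vanishes for every row separately. The noise energy, the cross term and the isotropy of
    i.i.d. rows are all brought to this centred form. Conditioning is expressed by integrals over
    history events only. To multiply by functions of the error [e_k], the identity map into the
    coarser sigma-algebra is used as a factor map. For i.i.d. rows the noise itself may fail to be
    integrable; hence moments are kept in the normalised forms [eps * a_j / |a|^2] and
    [eps^2 / |a|^2], which are integrable and are what the recursion consumes. The bounds
    [0 <= eta <= 1] are not assumed: when [x0 != x], they are read off from alignment at step 0. *)

Section IntegralAgainstFactor.
Context {R : realType} {d d' : measure_display} {T : measurableType d}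
  {Y : measurableType d'}.
Variables (mu : {measure set T -> \bar R}) (Z : T -> Y).
Hypothesis mZ : measurable_fun setT Z.

Import HBNNSimple.

(** The factor [g \o Z] is constant on each level set of [g], so it leaves the integral there. This
    is the simple-function case that monotone convergence extends below. *)
Lemma ge0_integral_nnsfun_factor (g : {nnsfun Y >-> R}) (U : T -> R) :
  measurable_fun setT U -> (forall w, 0 <= U w) ->
  (\int[mu]_w (g (Z w) * U w)%:E =
   \sum_(y \in range g)
     y%:E * \int[mu]_(w in Z @^-1` (g @^-1` [set y])) (U w)%:E)%E.
Proof.
move=> mU U0.
have mI y : measurable (Z @^-1` (g @^-1` [set y])).
  by rewrite -[X in measurable X]setTI; exact: mZ.
have mEU : measurable_fun setT (EFin \o U) by exact/measurable_EFinP.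
transitivity (\int[mu]_w \sum_(y \in range g)
    (y%:E * (((EFin \o U) \_ (Z @^-1` (g @^-1` [set y]))) w)))%E.
  apply: eq_integral => w _.
  rewrite (fsbigD1 (g (Z w)))//=; last by exists (Z w).
  rewrite fsbig1 ?adde0; last first.
    move=> y [_ /= ygw]; rewrite patchE memNset ?mule0//.
    by rewrite /= => E; apply: ygw.
  by rewrite patchE mem_set.
rewrite ge0_integral_fsum//.
- apply: eq_fsbigr => y; rewrite inE => -[y' _ <-].
  rewrite ge0_integralZl_EFin//.
  + by rewrite -integral_mkcond.
  + by move=> w _; rewrite patchE; case: ifP => //=; rewrite lee_fin.
  + by apply/measurable_restrict => //; apply: measurable_funS mEU.
- move=> y; apply: measurable_funeM.
  by apply/measurable_restrict => //; apply: measurable_funS mEU.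
- move=> y w _; rewrite patchE; case: ifPn => [|_]; last by rewrite mule0.
  by rewrite inE/= => <-; rewrite mule_ge0// lee_fin.
Qed.

Lemma ge0_integral_factor_eq (U V : T -> R) (f : Y -> R) :
  measurable_fun setT U -> (forall w, 0 <= U w) ->
  measurable_fun setT V -> (forall w, 0 <= V w) ->
  (forall C, measurable C ->
    \int[mu]_(w in Z @^-1` C) (U w)%:E = \int[mu]_(w in Z @^-1` C) (V w)%:E)%E ->
  measurable_fun setT f -> (forall y, 0 <= f y) ->
  (\int[mu]_w (f (Z w) * U w)%:E = \int[mu]_w (f (Z w) * V w)%:E)%E.
Proof.
move=> mU U0 mV V0 UV mf f0.
have mEf : measurable_fun setT (EFin \o f) by exact/measurable_EFinP.
pose g := nnsfun_approx measurableT mEf.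
have cvg_g (X : T -> R) : measurable_fun setT X -> (forall w, 0 <= X w) ->
    (\int[mu]_w (g n (Z w) * X w)%:E @[n --> \oo] -->
     \int[mu]_w (f (Z w) * X w)%:E)%E.
  move=> mX X0.
  have -> : (\int[mu]_w (f (Z w) * X w)%:E =
      \int[mu]_w limn ((fun n => fun w => (g n (Z w) * X w)%:E)^~ w))%E.
    apply: eq_integral => w _; apply/esym/cvg_lim => //.
    have h : EFin \o (g^~ (Z w)) @ \oo --> (EFin \o f) (Z w).
      by apply: cvg_nnsfun_approx => // y _; rewrite /= lee_fin.
    under eq_fun do rewrite EFinM; rewrite EFinM.
    by apply: cvgeZr.
  apply: cvg_monotone_convergence => //.
  - move=> n; apply/measurable_EFinP/measurable_funM => //.
    exact: measurableT_comp.
  - by move=> n w _; rewrite lee_fin mulr_ge0.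
  - move=> w _ a b ab; rewrite lee_fin ler_wpM2r//.
    exact/lefP/nd_nnsfun_approx.
have UVg : (fun n => \int[mu]_w (g n (Z w) * U w)%:E)%E =
           (fun n => \int[mu]_w (g n (Z w) * V w)%:E)%E.
  apply/funext => n; rewrite !ge0_integral_nnsfun_factor//.
  by apply: eq_fsbigr => y _; rewrite UV.
have := cvg_g _ mU U0; rewrite UVg => cU.
exact: (cvg_unique _ cU (cvg_g _ mV V0)).
Qed.

(* For Z the identity from T to T with a smaller sigma-algebra G, this says that
   E[W | G] = 0 makes W orthogonal to every G-measurable f. *)
Lemma integral_factor_eq0 (W : T -> R) (f : Y -> R) :
  mu.-integrable setT (EFin \o W) ->
  (forall C, measurable C -> (\int[mu]_(w in Z @^-1` C) (W w)%:E = 0)%E) ->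
  measurable_fun setT f ->
  mu.-integrable setT (fun w => (f (Z w) * W w)%:E) ->
  (\int[mu]_w (f (Z w) * W w)%:E = 0)%E.
Proof.
move=> iW W0 mf ifW.
have mW : measurable_fun setT W by exact/measurable_EFinP/(measurable_int _ iW).
have mfZ : measurable_fun setT (f \o Z) by exact: measurableT_comp.
have mWp := measurable_funrpos mW; have mWn := measurable_funrneg mW.
(* A signed integral that vanishes on every event says that the positive and negative parts of [W]
   have equal integrals there, so the nonnegative case applies to this pair. *)
have WE C : measurable C -> (\int[mu]_(w in Z @^-1` C) (W^\+ w)%:E =
    \int[mu]_(w in Z @^-1` C) (W^\- w)%:E)%E.
  move=> mC.
  have mZC : measurable (Z @^-1` C).
    by rewrite -[X in measurable X]setTI; exact: mZ.
  have iC : mu.-integrable (Z @^-1` C) (EFin \o W).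
    by apply: integrableS iW.
  have := W0 _ mC.
  rewrite integralE.
  have -> : (fun w => (W w)%:E)^\+%E = EFin \o W^\+ by rewrite -funerpos.
  have -> : (fun w => (W w)%:E)^\-%E = EFin \o W^\- by rewrite -funerneg.
  move=> /eqP; rewrite sube_eq ?add0e.
  - by move/eqP.
  - by rewrite (integrable_fin_num _ (integrable_funrpos mZC iC)).
  - exact: fin_num_adde_defr.
have mfp := measurable_funrpos mf; have mfn := measurable_funrneg mf.
have Ep : (\int[mu]_w (f^\+ (Z w) * W^\+ w)%:E =
           \int[mu]_w (f^\+ (Z w) * W^\- w)%:E)%E.
  by apply: ge0_integral_factor_eq.
have En : (\int[mu]_w (f^\- (Z w) * W^\+ w)%:E =
           \int[mu]_w (f^\- (Z w) * W^\- w)%:E)%E.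
  by apply: ge0_integral_factor_eq.
(* Each of the four products of signed parts is dominated by [|f W|], so the final differences never
   meet infinity minus infinity. *)
have iprod (h : Y -> R) (X : T -> R) :
    measurable_fun setT h -> measurable_fun setT X ->
    (forall y, `|h y| <= `|f y|) -> (forall w, `|X w| <= `|W w|) ->
    mu.-integrable setT (fun w => (h (Z w) * X w)%:E).
  move=> mh mX hf XW; apply: le_integrable ifW => //.
    by apply/measurable_EFinP/measurable_funM => //; exact: measurableT_comp.
  by move=> w _; rewrite !abse_EFin lee_fin !normrM ler_pM.
have posle (S : Type) (h : S -> R) s : `|h^\+ s| <= `|h s|.
  rewrite /funrpos; case: (leP 0 (h s)) => h0; rewrite ?normr0//.
have negle (S : Type) (h : S -> R) s : `|h^\- s| <= `|h s|.
  rewrite /funrneg; case: (leP 0 (- h s)) => h0; rewrite ?normrN ?normr0//.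
have ipp := iprod _ _ mfp mWp (posle _ f) (posle _ W).
have ipn := iprod _ _ mfp mWn (posle _ f) (negle _ W).
have inp := iprod _ _ mfn mWp (negle _ f) (posle _ W).
have inn := iprod _ _ mfn mWn (negle _ f) (negle _ W).
transitivity (\int[mu]_w
   (((f^\+ (Z w) * W^\+ w)%:E - (f^\+ (Z w) * W^\- w)%:E)
   - ((f^\- (Z w) * W^\+ w)%:E - (f^\- (Z w) * W^\- w)%:E)))%E.
  apply: eq_integral => w _; rewrite -!EFinB; congr EFin.
  rewrite -mulrBr -mulrBr -mulrBl.
  by have /(congr1 (@^~ (Z w)))/= <- := funrposBneg f;
     have /(congr1 (@^~ w))/= <- := funrposBneg W.
rewrite integralB//; [|exact: integrableB|exact: integrableB].
rewrite !integralB// Ep En !subee ?sube0//; exact: integrable_fin_num.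
Qed.

End IntegralAgainstFactor.

(** * Euclidean vectors *)

Section VectorMeasurability.
Context {R : realType} {d : measure_display} {T : measurableType d}.

(** Inversion is continuous only away from 0; the point 0, where the inverse takes its default
    value, is split off as a measurable singleton. *)
Lemma measurable_funV (f : T -> R) :
  measurable_fun setT f -> measurable_fun setT (fun w => (f w)^-1).
Proof.
move=> mf; apply: (@measurableT_comp _ _ _ _ _ _ (@GRing.inv R)) => //.
have -> : [set: R] = [set 0] `|` [set~ 0] by rewrite setUv.
apply/measurable_funU => //; first exact: measurableC.
split; first exact: measurable_fun_set1.
apply: open_continuous_measurable_fun => //.
  by rewrite openC; exact: closed_eq.
move=> x; rewrite inE => /eqP x0.
exact: inv_continuous.
Qed.

(** The sigma-algebra on the domain stays a parameter: the same predicate later expresses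
    measurability for the full space and for the history before a step. *)
Definition cv_measurable (n : nat) (u : T -> 'cV[R]_n) : Prop :=
  forall j, measurable_fun setT (fun w => u w j 0).

Lemma measurable_dot (n : nat) (u v : T -> 'cV[R]_n) :
  cv_measurable u -> cv_measurable v ->
  measurable_fun setT (fun w => dot (u w) (v w)).
Proof.
move=> mu mv; apply: measurable_sum => j.
by apply: measurable_funM; [exact: mu|exact: mv].
Qed.

Lemma measurable_l2norm (n : nat) (u : T -> 'cV[R]_n) :
  cv_measurable u -> measurable_fun setT (fun w => l2norm (u w)).
Proof.
move=> mu; apply: (@measurableT_comp _ _ _ _ _ _ (@Num.sqrt R)).
  by apply: continuous_measurable_fun; exact: sqrt_continuous.
exact: measurable_dot.
Qed.

Lemma cv_measurableD (n : nat) (u v : T -> 'cV[R]_n) :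
  cv_measurable u -> cv_measurable v -> cv_measurable (fun w => u w + v w).
Proof.
move=> mu mv j; under eq_fun do rewrite mxE.
by apply: measurable_funD; [exact: mu|exact: mv].
Qed.

Lemma cv_measurableZ (n : nat) (c : T -> R) (u : T -> 'cV[R]_n) :
  measurable_fun setT c -> cv_measurable u ->
  cv_measurable (fun w => c w *: u w).
Proof.
move=> mc mu j; under eq_fun do rewrite mxE.
by apply: measurable_funM; [exact: mc|exact: mu].
Qed.

Lemma cv_measurable_normalize (n : nat) (u : T -> 'cV[R]_n) :
  cv_measurable u -> cv_measurable (fun w => normalize (u w)).
Proof.
move=> mu; apply: cv_measurableZ => //.
exact/measurable_funV/measurable_l2norm.
Qed.

End VectorMeasurability.

Section Euclid.
Context {R : realType} {n : nat}.
Implicit Types (u v : 'cV[R]_n) (c : R).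

Lemma dotC u v : dot u v = dot v u.
Proof. by apply: eq_bigr => j _; rewrite mulrC. Qed.

Lemma dotDl u u' v : dot (u + u') v = dot u v + dot u' v.
Proof. by rewrite -big_split; apply: eq_bigr => j _; rewrite mxE mulrDl. Qed.

Lemma dotZl c u v : dot (c *: u) v = c * dot u v.
Proof. by rewrite mulr_sumr; apply: eq_bigr => j _; rewrite mxE mulrA. Qed.

Lemma dotNl u v : dot (- u) v = - dot u v.
Proof. by rewrite -scaleN1r dotZl mulN1r. Qed.

Lemma dot_ge0 u : 0 <= dot u u.
Proof. by apply: sumr_ge0 => j _; rewrite -expr2 sqr_ge0. Qed.

Lemma sqr_l2norm u : l2norm u ^+ 2 = dot u u.
Proof. by rewrite sqr_sqrtr// dot_ge0. Qed.

Lemma l2norm_ge0 u : 0 <= l2norm u. Proof. exact: sqrtr_ge0. Qed.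

Lemma l2norm_eq0 u : (l2norm u == 0) = (u == 0).
Proof.
rewrite sqrtr_eq0; apply/idP/idP => [u0|/eqP ->]; last first.
  by rewrite /dot big1// => j _; rewrite mxE mul0r.
have /eqP : dot u u == 0 by rewrite eq_le u0 dot_ge0.
rewrite /dot => /psumr_eq0P u2; apply/eqP/colP => j; rewrite mxE.
apply/eqP; rewrite -sqrf_eq0 expr2; apply/eqP/u2 => // i _.
by rewrite -expr2 sqr_ge0.
Qed.

Lemma l2normN u : l2norm (- u) = l2norm u.
Proof. by rewrite /l2norm dotNl dotC dotNl opprK. Qed.

Lemma dot_normalize u v :
  dot (normalize u) (normalize v) = dot u v / (l2norm u * l2norm v).
Proof.
by rewrite dotZl dotC dotZl dotC mulrA mulrC invfM.
Qed.

Lemma sqr_dot_le u v : dot u v ^+ 2 <= dot u u * dot v v.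
Proof.
have [v0|v0] := eqVneq (dot v v) 0.
  have /eqP : l2norm v == 0 by rewrite /l2norm v0 sqrtr0.
  move/eqP; rewrite l2norm_eq0 => /eqP ->.
  have z w : dot w (0 : 'cV[R]_n) = 0.
    by rewrite /dot big1// => j _; rewrite mxE mulr0.
  by rewrite !z expr0n mulr0.
have vgt0 : 0 < dot v v by rewrite lt0r v0 dot_ge0.
(* Cauchy-Schwarz without division: this squared norm equals [|v|^2 (|u|^2 |v|^2 - <u,v>^2)]. *)
have := dot_ge0 (dot v v *: u - dot u v *: v).
rewrite !(dotDl, dotZl, dotNl) ![dot _ (_ - _)]dotC !(dotDl, dotZl, dotNl).
rewrite (dotC v u) => H.
have : 0 <= dot v v * (dot u u * dot v v - dot u v ^+ 2).
  by move: H; congr (_ <= _); ring.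
by rewrite pmulr_rge0// subr_ge0.
Qed.

End Euclid.

(** * Independence of the past *)

Definition tuple_cv (R : realType) (n : nat) (t : n.-tuple R) : 'cV[R]_n :=
  \col_j tnth t j.

Lemma tuple_cv_row_tuple (R : realType) (m n : nat) (M : 'M[R]_(m, n))
  (i : 'I_m) : tuple_cv (row_tuple M i) = arow M i.
Proof. by apply/colP => j; rewrite !mxE tnth_mktuple. Qed.

Section RowNoiseModel.
Context {R : realType} {d : measure_display} {T : measurableType d}.
Variables (P : probability T R) (m n : nat).
Variables (A : T -> 'M[R]_(m, n)) (eps : 'I_m -> {RV P >-> R})
  (idx : nat -> T -> 'I_m) (sigma : R).

Definition observation (i : 'I_m) (w : T) : n.-tuple R * R :=
  (row_tuple (A w) i, eps i w).

(* The part common to the two sampling models; [rn_path_independent] says that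
   the observations (a_i, eps_i) are mutually independent and keep their laws
   given the order in which the rows are visited. *)
Record row_noise_model : Prop := {
  rn_idx_measurable : forall k i, (k < m)%N -> measurable (idx k @^-1` [set i]);
  rn_row_measurable : forall i,
    measurable_fun setT (fun w => row_tuple (A w) i);
  rn_path_independent :
    forall (h : nat -> 'I_m) (B : 'I_m -> set (n.-tuple R * R)),
    (forall i, measurable (B i)) ->
    P (path_event idx h m `&` [set w | forall i, B i (observation i w)])
    = (P (path_event idx h m) * \prod_i P (observation i @^-1` B i))%E;
  rn_path_inj : forall h : nat -> 'I_m, P (path_event idx h m) != 0 ->
    forall i j, (i < m)%N -> (j < m)%N -> h i = h j -> i = j;
  rn_noise_mean : forall i j, (\int[P]_w
    (eps i w * arow (A w) i j 0 / l2norm (arow (A w) i) ^+ 2)%:E = 0)%E;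
  rn_noise_variance : forall i, (\int[P]_w
    (eps i w ^+ 2 / l2norm (arow (A w) i) ^+ 2)%:E = (sigma ^+ 2)%:E)%E
}.

Hypothesis M : row_noise_model.

Lemma measurable_observation i : measurable_fun setT (observation i).
Proof. by apply: measurable_fun_pair => //; exact: (rn_row_measurable M). Qed.

Lemma measurable_observation_preimage i B : measurable B ->
  measurable (observation i @^-1` B).
Proof.
by move=> mB; rewrite -[X in measurable X]setTI; exact: measurable_observation.
Qed.

Lemma measurable_path_event h k : (k <= m)%N -> measurable (path_event idx h k).
Proof.
move=> km.
have -> : path_event idx h k = \bigcap_(j in `I_k) idx j @^-1` [set h j] by [].
apply: fin_bigcap_measurable => [|j /= jk]; first exact: finite_II.
 apply: (rn_idx_measurable M); exact: leq_trans km.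
Qed.

Lemma path_event_observations h l (B : nat -> set (n.-tuple R * R)) :
  (l <= m)%N -> (forall j, measurable (B j)) ->
  (forall i j, (i < m)%N -> (j < m)%N -> h i = h j -> i = j) ->
  P (path_event idx h m `&`
     [set w | forall j, (j < l)%N -> B j (observation (h j) w)])
  = (P (path_event idx h m) * \prod_(j < l) P (observation (h j) @^-1` B j))%E.
Proof.
move=> lm mB hinj.
(* Constraints indexed by steps become constraints indexed by rows. Since [h] is injective below
   [m], row [h j] receives exactly [B j], and a row not visited before [l] receives the whole
   space. *)
pose B' i := \bigcap_(j in `I_l) (if h j == i then B j else setT).
have hj (j j' : nat) : (j < l)%N -> (j' < l)%N -> h j = h j' -> j = j'.
  by move=> jl j'l; apply: hinj; exact: leq_trans lm.
have B'h (j : nat) : (j < l)%N -> B' (h j) = B j.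
  move=> jl; apply/seteqP; split => [y /(_ j jl)|y Bjy j' /= j'l].
    by rewrite eqxx.
  by case: eqP => // /hj ->.
have mB' i : measurable (B' i).
  by apply: fin_bigcap_measurable => [|j _]; [exact: finite_II|case: ifP].
have -> : [set w | forall j, (j < l)%N -> B j (observation (h j) w)] =
    [set w | forall i, B' i (observation i w)].
  apply/seteqP; split => w /= H.
    by move=> i j /= jl; case: eqP => // <-; exact: H.
  by move=> j jl; have := H (h j); rewrite B'h.
rewrite (rn_path_independent M)//; congr (_ * _)%E.
rewrite (bigID (fun i => i \in [set h (val j) | j : 'I_l]%SET))/=.
rewrite [X in (_ * X)%E]big1 ?mule1; last first.
  move=> i /negP hi; suff -> : B' i = setT by rewrite preimage_setT probability_setT.
  apply/seteqP; split => // y _ j /= jl; case: eqP => // hji.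
  by exfalso; apply: hi; apply/imsetP; exists (Ordinal jl).
rewrite big_imset/=; last first.
  by move=> j j' _ _ /hj E; apply/val_inj/E.
by apply: eq_bigr => j _; rewrite B'h.
Qed.

(** The generating family inside [history] gets a name so that the history can be used as the
    sigma-algebra of a type, on which measurable functions make sense. *)
Definition history_generators k : set (set T) :=
  [set S | exists2 j, (j < k)%N &
    (exists i, S = idx j @^-1` [set i]) \/
    (exists2 B : set (n.-tuple R * R), measurable B &
      S = (fun w => (row_tuple (A w) (idx j w), eps (idx j w) w)) @^-1` B)].

Lemma history_generators_measurable k : (k <= m)%N ->
  history_generators k `<=` measurable.
Proof.
move=> km S [j jk [[i ->]|[B mB ->]]].
  by apply: (rn_idx_measurable M); exact: leq_trans km.
have -> : (fun w => (row_tuple (A w) (idx j w), eps (idx j w) w)) @^-1` B =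
    \bigcup_(i in [set: 'I_m]) (idx j @^-1` [set i] `&` observation i @^-1` B).
  apply/seteqP; split => w /=; first by exists (idx j w).
  by case=> i _ [/= <-].
apply: fin_bigcup_measurable => // i _; apply: measurableI.
  by apply: (rn_idx_measurable M); exact: leq_trans km.
exact: measurable_observation_preimage.
Qed.

Lemma history_measurable k : (k <= m)%N ->
  history A eps idx k `<=` measurable.
Proof.
move=> km; apply: smallest_sub; first exact: sigma_algebra_measurable.
exact: history_generators_measurable.
Qed.

(* pi-lambda: given the path, the events of the history are, up to a pi-system,
   products of events of the observations h 0, ..., h (k - 1). *)
Lemma history_independent h k S C : (k < m)%N -> history A eps idx k S ->
  measurable C ->
  (forall i j, (i < m)%N -> (j < m)%N -> h i = h j -> i = j) ->
  P (S `&` (path_event idx h m `&` observation (h k) @^-1` C)) =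
  (P (observation (h k) @^-1` C) * P (S `&` path_event idx h m))%E.
Proof.
move=> km hS mC hinj.
pose D := path_event idx h m.
have mD : measurable D by exact: measurable_path_event.
have mDC : measurable (D `&` observation (h k) @^-1` C).
  by apply: measurableI => //; exact: measurable_observation_preimage.
(* As a nonnegative real, this probability can scale a measure: the claim becomes the equality at
   [S] of the two measures [P(. & D & obs^-1 C)] and [c P(. & D)]. *)
pose c : {nonneg R} := NngNum (fine_ge0 (measure_ge0 P (observation (h k) @^-1` C))).
have cE : (c%:num%:E = P (observation (h k) @^-1` C))%E.
  by rewrite /= fineK// fin_num_measure//; exact: measurable_observation_preimage.
pose G := [set S | measurable S /\ exists B : nat -> set (n.-tuple R * R),
  (forall j, measurable (B j)) /\
  D `&` S = D `&` [set w | forall j, (j < k)%N -> B j (observation (h j) w)]].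
have HG : history A eps idx k `<=` <<s G >>.
  apply: sub_sigma_algebra2 => X gX; split.
    by apply: (history_generators_measurable (ltnW km)).
  case: gX => j jk [[i ->]|[B mB ->]].
  (* Inside the path event the index at step [j] is [h j], so an index event is all or nothing
     there. *)
  - exists (fun=> if h j == i then setT else set0); split.
      by move=> _; case: ifP.
    have jm := ltn_trans jk km.
    apply/seteqP; split => w /= [Dw]; rewrite (Dw j jm) => H; split=> //.
      by move=> j' _; rewrite H eqxx.
    by have := H j jk; case: eqP.
  - exists (fun j' => if j' == j then B else setT); split.
      by move=> j'; case: ifP.
    have jm := ltn_trans jk km.
    apply/seteqP; split => w /= [Dw]; rewrite (Dw j jm) => H; split=> //.
      by move=> j' _; case: eqP => // ->.
    by have := H j jk; rewrite eqxx.
have GT : G setT.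
  split => //; exists (fun=> setT); split => //.
  by rewrite setIT; apply/seteqP; split => w //= [].
rewrite -cE.
have key := g_sigma_algebra_measure_unique G _ (fun=> setT) _ _
  (mrestr P mDC) (mscale c (mrestr P mD)).
rewrite -/(mrestr P mDC S) -/(mrestr P mD S).
rewrite -[RHS]/(mscale c (mrestr P mD) S).
apply: key.
- by move=> X [].
- by [].
- by apply/seteqP; split => // w _; exists 0%N.
- move=> X Y [mX [B [mB XE]]] [mY [B' [mB' YE]]]; split; first exact: measurableI.
  exists (fun j => B j `&` B' j); split => [j|]; first exact: measurableI.
  rewrite setIIr XE YE -setIIr; congr (_ `&` _).
  apply/seteqP; split => w /= => [[HB HB'] j jk|H].
    by split; [exact: HB|exact: HB'].
  by split=> j jk; have [] := H j jk.
- move=> X [mX [B [mB XE]]]; 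
  rewrite -[LHS]/(P (X `&` (D `&` observation (h k) @^-1` C))).
  rewrite -[RHS]/(c%:num%:E * P (X `&` D))%E.
  rewrite setIA (setIC X D) XE.
  (* Appending [C] as the constraint of step [k] makes both sides instances of one product formula,
     with [k.+1] and [k] factors. *)
  pose B' j := if (j < k)%N then B j else C.
  have mB' j : measurable (B' j) by rewrite /B'; case: ifP.
  have -> : D `&` [set w | forall j, (j < k)%N -> B j (observation (h j) w)] `&`
      observation (h k) @^-1` C =
      D `&` [set w | forall j, (j < k.+1)%N -> B' j (observation (h j) w)].
    apply/seteqP; split => w /=.
      move=> [[Dw H] Cw]; split=> // j; rewrite /B' ltnS leq_eqVlt.
      by case/predU1P => [->|jk]; [rewrite ltnn|rewrite jk; exact: H].
    move=> [Dw H]; split; first split => //.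
      by move=> j jk; have := H j (leqW jk); rewrite /B' jk.
    by have := H k (ltnSn k); rewrite /B' ltnn.
  rewrite !path_event_observations// ?(ltnW km)// cE big_ord_recr/= /B' ltnn.
  rewrite muleA muleC; congr (_ * (_ * _))%E.
  by apply: eq_bigr => j _; rewrite ltn_ord.
- by move=> _; rewrite /= /mrestr ltey_eq fin_num_measure//; exact: measurableI.
- exact: HG.
Qed.

End RowNoiseModel.

Section IndicatorIntegral.
Context {R : realType} {d : measure_display} {T : measurableType d}.
Variable mu : {measure set T -> \bar R}.

Lemma integral_indicM (S : set T) (g : T -> R) :
  (\int[mu]_(w in S) (g w)%:E = \int[mu]_w (\1_S w * g w)%:E)%E.
Proof.
rewrite integral_mkcond; apply: eq_integral => w _.
by rewrite patchE indicE; case: ifP => _; rewrite ?mul1r ?mul0r.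
Qed.

Lemma integrable_indicM (S : set T) (g : T -> R) : measurable S ->
  mu.-integrable setT (EFin \o g) ->
  mu.-integrable setT (fun w => (\1_S w * g w)%:E).
Proof.
move=> mS ig; apply: le_integrable (ig) => //.
  apply/measurable_EFinP/measurable_funM; first exact: measurable_indic.
  exact/measurable_EFinP/(measurable_int _ ig).
move=> w _; rewrite /= lee_fin normrM indicE.
by case: (w \in S); rewrite ?normr1 ?normr0 ?mul1r ?mul0r.
Qed.

End IndicatorIntegral.

Lemma integral_cst_probability {R : realType} {d : measure_display}
    {T : measurableType d} (P : probability T R) (c : R) :
  (\int[P]_w (cst c w)%:E = c%:E)%E.
Proof. by have := expectation_cst P c; rewrite unlock. Qed.

(** * Averages over the observation met at a random index *)

Section FreshObservation.
Context {R : realType} {d : measure_display} {T : measurableType d}.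
Variables (P : probability T R) (m n : nat).
Variables (A : T -> 'M[R]_(m, n)) (eps : 'I_m -> {RV P >-> R})
  (idx : nat -> T -> 'I_m) (sigma : R).
Hypothesis M : row_noise_model A eps idx sigma.

Local Notation obs := (observation A eps).

Lemma measurable_fresh_observation k : (k < m)%N ->
  measurable_fun setT (fun w => obs (idx k w) w).
Proof.
move=> km _ B mB; rewrite setTI.
apply: (history_generators_measurable M km); exists k => //.
by right; exists B.
Qed.

(** There are finitely many rows, so the value at the random index is dominated by the sum of the
    absolute values over all rows. *)
Lemma integrable_fresh (phi : n.-tuple R * R -> R) k : (k < m)%N ->
  measurable_fun setT phi ->
  (forall i, P.-integrable setT (fun w => (phi (obs i w))%:E)) ->
  P.-integrable setT (fun w => (phi (obs (idx k w) w))%:E).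
Proof.
move=> km mphi iphi.
have isum : P.-integrable setT
    (fun w => \sum_(i < m) (`|phi (obs i w)|)%:E)%E.
  by apply: integrable_sum => // i _; exact: integrable_norm (iphi i).
apply: le_integrable isum => //.
  apply/measurable_EFinP.
  exact: (measurableT_comp mphi (measurable_fresh_observation km)).
move=> w _; rewrite sumEFin !abse_EFin lee_fin [leRHS]ger0_norm ?sumr_ge0//.
by rewrite (bigD1 (idx k w))//= lerDl sumr_ge0.
Qed.

(** With [E] the intersection of [S] and the path event, independence says that [1_E - P(E)]
    integrates to 0 over every event of the observation [h k]. It is therefore orthogonal to [phi]
    of that observation, whose integral over [E] is [P(E)] times its mean 0. Null paths are treated
    apart, because injectivity of [h] is known only for paths of positive probability. *)
Lemma integral_path_fresh (phi : n.-tuple R * R -> R) h k S : (k < m)%N ->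
  measurable_fun setT phi ->
  (forall i, P.-integrable setT (fun w => (phi (obs i w))%:E)) ->
  (forall i, \int[P]_w (phi (obs i w))%:E = 0)%E ->
  history A eps idx k S ->
  (\int[P]_w (\1_(S `&` path_event idx h m) w * phi (obs (h k) w))%:E = 0)%E.
Proof.
move=> km mphi iphi phi0 hS.
have mS : measurable S by exact: (history_measurable M (ltnW km)).
have mD : measurable (path_event idx h m) by exact: (measurable_path_event M).
set E := S `&` path_event idx h m.
have mE : measurable E by exact: measurableI.
have [D0|D0] := eqVneq (P (path_event idx h m)) 0%E.
  have PE0 : P E = 0%E.
    apply/eqP; rewrite eq_le measure_ge0 andbT -D0.
    by apply: le_measure; rewrite ?inE// => w [].
  rewrite -integral_indicM; apply: null_set_integral => //.
  apply: measurable_funS (measurable_int _ (iphi (h k))) => //.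
have hinj := rn_path_inj M D0.
pose c := fine (P E).
have cE : (c%:E = P E)%E by rewrite fineK// fin_num_measure.
have i1 : P.-integrable setT (EFin \o (\1_E : T -> R)).
  exact: integrable_indic.
have ic : P.-integrable setT (EFin \o cst c).
  by apply: finite_measure_integrable_cst.
have ifE := integrable_indicM mE (iphi (h k)).
have icf : P.-integrable setT (fun w => (c * phi (obs (h k) w))%:E).
  by under eq_fun do rewrite EFinM; exact: integrableZl.
have W0 C : measurable C ->
    (\int[P]_(w in obs (h k) @^-1` C) ((\1_E \- cst c) w)%:E = 0)%E.
  move=> mC; have mZC := measurable_observation_preimage M (h k) mC.
  under eq_integral do rewrite EFinB.
  rewrite integralB_EFin//; [|exact: integrableS i1|exact: integrableS ic].
  rewrite integral_indic//.
  have -> : (\int[P]_(w in obs (h k) @^-1` C) (cst c w)%:E =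
      c%:E * P (obs (h k) @^-1` C))%E by exact: (integral_cst _ mZC c%:E).
  rewrite cE {1}/E -setIA.
  transitivity (P (obs (h k) @^-1` C) * P E - P E * P (obs (h k) @^-1` C))%E.
    by congr (_ - _)%E; exact: (history_independent M km hS mC hinj).
  by rewrite muleC subee// fin_numM// fin_num_measure.
have iW : P.-integrable setT (EFin \o (\1_E \- cst c : T -> R)).
  by rewrite (_ : _ \o _ = (EFin \o \1_E) \- (EFin \o cst c))%E//;
    exact: integrableB.
have sub : (fun w => (phi (obs (h k) w) * (\1_E \- cst c) w)%:E) =
    ((fun w => (\1_E w * phi (obs (h k) w))%:E) \-
     (fun w => (c * phi (obs (h k) w))%:E))%E.
  by apply/funext => w; rewrite /= -EFinB mulrBr mulrC [c * _]mulrC.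
have := integral_factor_eq0 (measurable_observation M (h k)) iW W0 mphi.
rewrite sub => /(_ (integrableB measurableT ifE icf)).
rewrite integralB//.
under [X in (_ - X)%E]eq_integral do rewrite EFinM.
by rewrite integralZl// phi0 mule0 sube0.
Qed.

(** A finite function encodes the visiting order, so that orders can be summed over; [km] supplies
    an index to use as the value from [m] on. *)
Definition extend_path k (km : (k < m)%N) (h : {ffun 'I_m -> 'I_m}) (j : nat) :
  'I_m := if insub j is Some j' then h j' else Ordinal km.

Lemma extend_path_ord k (km : (k < m)%N) h (j : 'I_m) :
  extend_path km h j = h j.
Proof. by rewrite /extend_path valK. Qed.

Lemma path_event_extend_path k (km : (k < m)%N) h w :
  path_event idx (extend_path km h) m w <-> h = [ffun j : 'I_m => idx j w].
Proof.
split => [H|->].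
  by apply/ffunP => j; rewrite ffunE H// extend_path_ord.
by move=> j jm; rewrite -[j]/(val (Ordinal jm)) extend_path_ord ffunE.
Qed.

(** Each outcome lies in exactly one path event, and there the index at step [k] is the
    deterministic [h k]. Asking for mean 0 row by row is what makes the result insensitive to how
    the past influences the choice of the row. *)
Lemma integral_fresh_eq0 (phi : n.-tuple R * R -> R) k S : (k < m)%N ->
  measurable_fun setT phi ->
  (forall i, P.-integrable setT (fun w => (phi (obs i w))%:E)) ->
  (forall i, \int[P]_w (phi (obs i w))%:E = 0)%E ->
  history A eps idx k S ->
  (\int[P]_(w in S) (phi (obs (idx k w) w))%:E = 0)%E.
Proof.
move=> km mphi iphi phi0 hS.
have mS : measurable S by exact: (history_measurable M (ltnW km)).
rewrite (integral_indicM P S (fun w => phi (obs (idx k w) w))).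
pose F h w := \1_(S `&` path_event idx (extend_path km h) m) w *
  phi (obs (extend_path km h k) w).
transitivity (\int[P]_w \sum_(h : {ffun 'I_m -> 'I_m}) (F h w)%:E)%E.
  apply: eq_integral => w _; pose h0 := [ffun j : 'I_m => idx j w].
  have Dh0 : path_event idx (extend_path km h0) m w.
    exact/path_event_extend_path.
  rewrite (bigD1 h0)//= big1 ?adde0; last first.
    move=> h /eqP hh0; rewrite /F indicE memNset ?mul0r//.
    by move=> [_ /path_event_extend_path].
  rewrite /F !indicE in_setI (mem_set Dh0) andbT.
  by rewrite -[k]/(val (Ordinal km)) extend_path_ord ffunE.
rewrite integral_sum//; last first.
  move=> h; apply: integrable_indicM; last exact: iphi.
  by apply: measurableI => //; exact: (measurable_path_event M).
by apply: big1 => h _; exact: integral_path_fresh.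
Qed.

End FreshObservation.

Lemma sqr_dot_addZ (R : realType) n c (u v : 'cV[R]_n) :
  dot (u + c *: v) (u + c *: v) = dot u u + 2 * c * dot v u + c ^+ 2 * dot v v.
Proof.
rewrite dotDl dotZl ![dot _ (u + _)]dotC !dotDl !dotZl (dotC v u).
by ring.
Qed.

(** * The error recursion *)

Section Iteration.
Context {R : realType} {d : measure_display} {T : measurableType d}.
Variables (P : probability T R) (m n : nat).
Variables (A : T -> 'M[R]_(m, n)) (b : T -> 'cV[R]_m)
  (eps : 'I_m -> {RV P >-> R}) (idx : nat -> T -> 'I_m) (x x0 : 'cV[R]_n)
  (sigma : R).
Hypothesis solution : forall w, A w *m x = b w.

Local Notation obs := (observation A eps).
Local Notation H k := (g_sigma_algebraType (history_generators A eps idx k)).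

Lemma history_mono k l : (k <= l)%N ->
  history A eps idx k `<=` history A eps idx l.
Proof.
move=> kl; apply: sub_sigma_algebra2 => S [j jk gS].
by exists j => //; exact: leq_trans kl.
Qed.

Lemma history_measurable_funW k l (f : T -> R) : (k <= l)%N ->
  measurable_fun setT (f : H k -> R) -> measurable_fun setT (f : H l -> R).
Proof.
move=> kl mf _ B mB; apply: (history_mono kl).
exact: (mf measurableT B mB).
Qed.

Lemma history_measurable_obs k : 
  measurable_fun setT ((fun w => obs (idx k w) w) : H k.+1 -> _).
Proof.
move=> _ B mB; rewrite setTI; apply: sub_sigma_algebra.
by exists k => //; right; exists B.
Qed.

Lemma cv_measurable_tuple_cv : cv_measurable (@tuple_cv R n).
Proof.
move=> j; under eq_fun do rewrite mxE; exact: measurable_tnth.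
Qed.

Lemma rhsE w i : b w i 0 = dot (arow (A w) i) x.
Proof.
by rewrite -solution mxE; apply: eq_bigr => j _; rewrite !mxE.
Qed.

Variable alpha : nat -> R.
Local Notation xk := (iterate A b eps idx alpha x0).

Definition step_error k w := xk k w - x.
Local Notation e := step_error.
Local Notation a k w := (arow (A w) (idx k w)).

(** Because [A x = b], the residual of the chosen row is its noise minus [<a, e>]; the error thus
    evolves without reference to [b]. *)
Lemma step_errorS k w :
  e k.+1 w = e k w + (alpha k *
    ((eps (idx k w) w - dot (a k w) (e k w)) / l2norm (a k w) ^+ 2)) *: a k w.
Proof.
rewrite /e /= -addrAC; congr (_ + _ *: _); congr (_ * (_ / _)).
rewrite mxE rhsE [dot _ (_ - x)]dotC dotDl dotNl.
by rewrite ![dot _ (arow _ _)]dotC; ring.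
Qed.

(** Measurability for the history, not just for the full sigma-algebra, is what allows the error to
    multiply variables that are centred given the past. *)
Lemma cv_measurable_step_error k : cv_measurable (e k : H k -> 'cV[R]_n).
Proof.
elim: k => [|k IH]; first by move=> j; rewrite /e/=; exact: measurable_cst.
rewrite (_ : e k.+1 = fun w => e k w + (alpha k *
    ((eps (idx k w) w - dot (a k w) (e k w)) / l2norm (a k w) ^+ 2)) *: a k w);
  last by apply/funext => w; exact: step_errorS.
have mobs := history_measurable_obs (k := k).
have ma : cv_measurable ((fun w => a k w) : H k.+1 -> 'cV[R]_n).
  move=> j; rewrite (_ : (fun w => _) =
      (fun y : n.-tuple R * R => tuple_cv y.1 j 0) \o
      (fun w => obs (idx k w) w)); last first.
    by apply/funext => w /=; rewrite tuple_cv_row_tuple.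
  apply: measurableT_comp mobs.
  by apply: (measurableT_comp (cv_measurable_tuple_cv j)).
have meps : measurable_fun setT ((fun w => eps (idx k w) w) : H k.+1 -> R).
  exact: (measurableT_comp measurable_snd mobs).
have me : cv_measurable (e k : H k.+1 -> 'cV[R]_n).
  by move=> j; exact: (history_measurable_funW (leqnSn k) (IH j)).
apply: cv_measurableD => //; apply: cv_measurableZ => //.
apply: measurable_funM => //; apply: measurable_funM.
  by apply: measurable_funB => //; exact: measurable_dot.
by apply: measurable_funV; apply: measurable_funX; exact: measurable_l2norm.
Qed.

Lemma sqr_l2norm_step_error k w :
  l2norm (e k.+1 w) ^+ 2 = l2norm (e k w) ^+ 2
   - (2 * alpha k - alpha k ^+ 2) *
       (dot (a k w) (e k w) ^+ 2 / l2norm (a k w) ^+ 2)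
   + 2 * alpha k * (1 - alpha k) *
       (eps (idx k w) w * dot (a k w) (e k w) / l2norm (a k w) ^+ 2)
   + alpha k ^+ 2 * (eps (idx k w) w ^+ 2 / l2norm (a k w) ^+ 2).
Proof.
rewrite step_errorS !sqr_l2norm sqr_dot_addZ.
set u := e k w; set v := a k w.
(* For a zero row every quotient by its squared norm is 0 by convention: there is no update and both
   sides reduce to the old squared error. *)
have [v0|v0] := eqVneq (dot v v) 0; last by field.
by rewrite v0 invr0; ring.
Qed.

End Iteration.

(** * Domination of the normalised noise *)

Lemma sqr_coord_le (R : realType) (n : nat) (u : 'cV[R]_n) j :
  u j 0 ^+ 2 <= l2norm u ^+ 2.
Proof.
rewrite sqr_l2norm /dot (bigD1 j)//= -expr2 lerDl.
by apply: sumr_ge0 => i _; rewrite -expr2 sqr_ge0.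
Qed.

(** A coordinate of a normalised vector has absolute value at most 1, so the normalised noise
    inherits square integrability from [c / |u|]. *)
Lemma sqr_noise_row_le (R : realType) (n : nat) (c : R) (u : 'cV[R]_n) j :
  (c * u j 0 / l2norm u ^+ 2) ^+ 2 <= c ^+ 2 / l2norm u ^+ 2.
Proof.
have [->|u0] := eqVneq (l2norm u) 0.
  by rewrite expr0n/= invr0 !mulr0 expr0n.
have N0 : 0 < l2norm u ^+ 2 by rewrite exprn_even_gt0.
rewrite !exprMn exprVn -mulrA ler_wpM2l ?sqr_ge0//.
rewrite -[leRHS]mul1r expr2 invfM mulrA ler_wpM2r ?invr_ge0 ?(ltW N0)//.
by rewrite ler_pdivrMr// mul1r sqr_coord_le.
Qed.

Lemma norm_le1D (R : realType) (r : R) : `|r| <= 1 + r ^+ 2.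
Proof. by rewrite -real_normK ?num_real//; have := sqr_ge0 (`|r| - 1); nra. Qed.

Lemma integrable_of_sqr {R : realType} {d : measure_display}
    {T : measurableType d} (P : probability T R) (S : set T) (f : T -> R) :
  measurable S -> measurable_fun S f ->
  P.-integrable S (fun w => (f w ^+ 2)%:E) -> P.-integrable S (EFin \o f).
Proof.
move=> mS mf isq.
have i1 : P.-integrable S (EFin \o cst 1).
  exact: finite_measure_integrable_cst.
apply: le_integrable (integrableD mS i1 isq) => //.
  exact/measurable_EFinP.
move=> w _; rewrite /= lee_fin; apply: (le_trans (norm_le1D _)).
by rewrite ger0_norm// addr_ge0 ?sqr_ge0.
Qed.

Lemma integrable_noise_mul_coord {R : realType} {d : measure_display}
    {T : measurableType d} (P : probability T R) (n : nat) (c : T -> R)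
    (u : T -> 'cV[R]_n) (j : 'I_n) :
  measurable_fun setT c -> cv_measurable u ->
  P.-integrable setT (fun w => (c w ^+ 2 / l2norm (u w) ^+ 2)%:E) ->
  P.-integrable setT (fun w => (c w * u w j 0 / l2norm (u w) ^+ 2)%:E).
Proof.
move=> mc mu isq.
have i1 : P.-integrable setT (EFin \o cst 1).
  exact: finite_measure_integrable_cst.
apply: le_integrable (integrableD measurableT i1 isq) => //.
  apply/measurable_EFinP; apply: measurable_funM.
    by apply: measurable_funM => //; exact: mu.
  by apply: measurable_funV; apply: measurable_funX; exact: measurable_l2norm.
move=> w _; rewrite /= lee_fin; apply: (le_trans (norm_le1D _)).
rewrite (ger0_norm (addr_ge0 _ _)) ?lerD2l ?sqr_noise_row_le//.
by rewrite divr_ge0 ?sqr_ge0.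
Qed.

Section ErrorRecursion.
Context {R : realType} {d : measure_display} {T : measurableType d}.
Variables (P : probability T R) (m n : nat).
Variables (A : T -> 'M[R]_(m, n)) (b : T -> 'cV[R]_m)
  (eps : 'I_m -> {RV P >-> R}) (idx : nat -> T -> 'I_m) (x x0 : 'cV[R]_n)
  (sigma : R).
Hypothesis solution : forall w, A w *m x = b w.
Hypothesis M : row_noise_model A eps idx sigma.

Local Notation obs := (observation A eps).
Local Notation H k := (g_sigma_algebraType (history_generators A eps idx k)).

Variable alpha : nat -> R.
Local Notation xk := (iterate A b eps idx alpha x0).
Local Notation e := (step_error A b eps idx x x0 alpha).
Local Notation a k w := (arow (A w) (idx k w)).

Lemma history_idfun_measurable k : (k <= m)%N ->
  measurable_fun setT (idfun : T -> H k).
Proof.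
by move=> km _ B mB; rewrite setTI; exact: (history_measurable M km).
Qed.

Lemma history_measurable_fun k (f : T -> R) : (k <= m)%N ->
  measurable_fun setT (f : H k -> R) -> measurable_fun setT f.
Proof.
by move=> km mf; exact: (measurableT_comp mf (history_idfun_measurable km)).
Qed.

Lemma measurable_obs_noise : measurable_fun setT
  (fun y : n.-tuple R * R => y.2 ^+ 2 / l2norm (tuple_cv y.1) ^+ 2).
Proof.
apply: measurable_funM; first by apply: measurable_funX; exact: measurable_snd.
apply: measurable_funV; apply: measurable_funX.
apply: (measurableT_comp (measurable_l2norm (@cv_measurable_tuple_cv _ _))).
exact: measurable_fst.
Qed.

Lemma measurable_obs_noise_row j : measurable_fun setT
  (fun y : n.-tuple R * R => y.2 * tuple_cv y.1 j 0 / l2norm (tuple_cv y.1) ^+ 2).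
Proof.
apply: measurable_funM.
  apply: measurable_funM; first exact: measurable_snd.
  exact: (measurableT_comp (cv_measurable_tuple_cv j) measurable_fst).
apply: measurable_funV; apply: measurable_funX.
apply: (measurableT_comp (measurable_l2norm (@cv_measurable_tuple_cv _ _))).
exact: measurable_fst.
Qed.

Lemma integrable_obs_noise i : P.-integrable setT
  (fun w => (eps i w ^+ 2 / l2norm (arow (A w) i) ^+ 2)%:E).
Proof.
apply/integrableP; split.
  apply/measurable_EFinP.
  under eq_fun do rewrite -tuple_cv_row_tuple.
  exact: (measurableT_comp measurable_obs_noise (measurable_observation M i)).
under eq_integral do
  rewrite gee0_abs ?lee_fin ?divr_ge0 ?sqr_ge0//.
by rewrite (rn_noise_variance M) ltry.
Qed.

Lemma integrable_obs_noise_row i j : P.-integrable setT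
  (fun w => (eps i w * arow (A w) i j 0 / l2norm (arow (A w) i) ^+ 2)%:E).
Proof.
apply: integrable_noise_mul_coord (integrable_obs_noise i) => //.
move=> j'; under eq_fun do rewrite -tuple_cv_row_tuple.
exact: (measurableT_comp (measurableT_comp (cv_measurable_tuple_cv j')
  measurable_fst) (measurable_observation M i)).
Qed.

(** * Expectation of each term of the expansion at one step *)

Section Step.
Variable k : nat.
Hypothesis km : (k < m)%N.

Let noise w := eps (idx k w) w ^+ 2 / l2norm (a k w) ^+ 2.
Let cross w := eps (idx k w) w * dot (a k w) (e k w) / l2norm (a k w) ^+ 2.
Let proj w := dot (a k w) (e k w) ^+ 2 / l2norm (a k w) ^+ 2.
Let err w := l2norm (e k w) ^+ 2.

Lemma integrable_noise : P.-integrable setT (EFin \o noise).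
Proof.
have := integrable_fresh M km measurable_obs_noise.
rewrite /noise /comp /=; under eq_fun do rewrite /= tuple_cv_row_tuple.
apply=> i; under eq_fun do rewrite /= tuple_cv_row_tuple.
exact: integrable_obs_noise.
Qed.

Lemma integral_noise : (\int[P]_w (noise w)%:E = (sigma ^+ 2)%:E)%E.
Proof.
have ic (S : set T) : measurable S ->
    P.-integrable S (EFin \o cst (sigma ^+ 2)).
  by move=> mS; exact: finite_measure_integrable_cst.
(* Subtracting [sigma ^+ 2] centres the normalised noise energy for every row at once, as
   [integral_fresh_eq0] demands; it is then applied on the sure event. *)
pose phi (y : n.-tuple R * R) :=
  y.2 ^+ 2 / l2norm (tuple_cv y.1) ^+ 2 - sigma ^+ 2.
have mphi : measurable_fun setT phi.
  by apply: measurable_funB => //; exact: measurable_obs_noise.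
have phiE i w : phi (obs i w) =
    eps i w ^+ 2 / l2norm (arow (A w) i) ^+ 2 - sigma ^+ 2.
  by rewrite /phi/= tuple_cv_row_tuple.
have iphi i : P.-integrable setT (fun w => (phi (obs i w))%:E).
  under eq_fun do rewrite phiE EFinB.
  by apply: integrableB => //; [exact: integrable_obs_noise|exact: ic].
have phi0 i : (\int[P]_w (phi (obs i w))%:E = 0)%E.
  under eq_integral do rewrite phiE EFinB.
  rewrite (integralB_EFin measurableT (integrable_obs_noise i)
    (ic _ measurableT)).
  by rewrite (rn_noise_variance M) integral_cst_probability subee.
have hT : history A eps idx k setT by exact: (@measurableT _ (H k)).
have := integral_fresh_eq0 M km mphi iphi phi0 hT.
under eq_integral do rewrite phiE EFinB.
rewrite (integralB_EFin measurableT integrable_noise (ic _ measurableT)).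
rewrite integral_cst_probability.
by move=> /eqP; rewrite sube_eq ?add0e// => [/eqP//|];
  rewrite (integrable_fin_num _ integrable_noise).
Qed.

Lemma cv_measurable_step_errorT : cv_measurable (e k).
Proof.
move=> j; apply: (history_measurable_fun (ltnW km)).
exact: (cv_measurable_step_error x0 solution).
Qed.

Lemma cv_measurable_row : cv_measurable (fun w => a k w).
Proof.
move=> j; rewrite (_ : (fun w => _) =
    (fun y : n.-tuple R * R => tuple_cv y.1 j 0) \o
    (fun w => obs (idx k w) w)); last first.
  by apply/funext => w /=; rewrite tuple_cv_row_tuple.
apply: measurableT_comp (measurable_fresh_observation M km).
exact: (measurableT_comp (cv_measurable_tuple_cv j) measurable_fst).
Qed.

Hypothesis ierr : P.-integrable setT (EFin \o err).

Lemma proj_le w : proj w <= err w.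
Proof.
rewrite /proj /err; have [->|a0] := eqVneq (l2norm (a k w)) 0.
  by rewrite expr0n/= invr0 mulr0 sqr_ge0.
rewrite ler_pdivrMr ?exprn_even_gt0// mulrC !sqr_l2norm; exact: sqr_dot_le.
Qed.

Lemma proj_ge0 w : 0 <= proj w.
Proof. by rewrite divr_ge0 ?sqr_ge0. Qed.

Lemma integrable_proj : P.-integrable setT (EFin \o proj).
Proof.
apply: le_integrable ierr => //.
  apply/measurable_EFinP/measurable_funM.
    apply: measurable_funX; apply: measurable_dot; first exact: cv_measurable_row.
    exact: cv_measurable_step_errorT.
  apply: measurable_funV; apply: measurable_funX.
  exact/measurable_l2norm/cv_measurable_row.
move=> w _; rewrite /= lee_fin !ger0_norm ?proj_ge0 ?proj_le//.
by rewrite sqr_ge0.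
Qed.

Let noise_row j w := eps (idx k w) w * a k w j 0 / l2norm (a k w) ^+ 2.

Lemma integrable_noise_row j : P.-integrable setT (EFin \o noise_row j).
Proof.
have := integrable_fresh M km (measurable_obs_noise_row j).
rewrite /noise_row /comp /=; under eq_fun do rewrite /= tuple_cv_row_tuple.
apply=> i; under eq_fun do rewrite /= tuple_cv_row_tuple.
exact: integrable_obs_noise_row.
Qed.

Lemma integrable_error_noise_row j :
  P.-integrable setT (fun w => (e k w j 0 * noise_row j w)%:E).
Proof.
apply: le_integrable (integrableD measurableT ierr integrable_noise) => //.
  apply/measurable_EFinP/measurable_funM; first exact: cv_measurable_step_errorT.
  exact/measurable_EFinP/(measurable_int _ (integrable_noise_row j)).
move=> w _; rewrite /= lee_fin [leRHS]ger0_norm; last first.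
  by rewrite addr_ge0 ?sqr_ge0// divr_ge0 ?sqr_ge0.
(* The product is bounded by the sum of the squares, which splits it into the already integrable
   squared error and noise energy. *)
apply: (@le_trans _ _ (e k w j 0 ^+ 2 + noise_row j w ^+ 2)).
  rewrite normrM -[e k w j 0 ^+ 2]real_normK ?num_real//.
  rewrite -[noise_row j w ^+ 2]real_normK ?num_real//.
  by have := sqr_ge0 (`|e k w j 0| - `|noise_row j w|);
     have := normr_ge0 (e k w j 0); have := normr_ge0 (noise_row j w); nra.
by rewrite lerD ?sqr_coord_le// sqr_noise_row_le.
Qed.

Lemma crossE w : (cross w)%:E = (\sum_j (e k w j 0 * noise_row j w)%:E)%E.
Proof.
rewrite sumEFin; congr EFin; rewrite /cross /dot mulr_sumr mulr_suml.
by apply: eq_bigr => j _; rewrite /noise_row; ring.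
Qed.

Lemma integrable_cross : P.-integrable setT (EFin \o cross).
Proof.
rewrite (_ : EFin \o cross = fun w => \sum_j (e k w j 0 * noise_row j w)%:E)%E;
  last by apply/funext => w; exact: crossE.
by apply: integrable_sum => // j _; exact: integrable_error_noise_row.
Qed.

(** The inner product is split into coordinates, so that each summand is a history-measurable scalar
    [e k w j 0] times a function of the fresh observation that is centred for every row. *)
Lemma integral_cross : (\int[P]_w (cross w)%:E = 0)%E.
Proof.
under eq_integral do rewrite crossE.
rewrite integral_sum//; last by move=> j; exact: integrable_error_noise_row.
apply: big1 => j _.
have hid := history_idfun_measurable (ltnW km).
apply: (integral_factor_eq0 hid (f := fun w : H k => e k w j 0)).
- exact: integrable_noise_row.
- move=> C hC; rewrite preimage_id.
  have phiE i w : (fun y : n.-tuple R * R =>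
      y.2 * tuple_cv y.1 j 0 / l2norm (tuple_cv y.1) ^+ 2) (obs i w) =
      eps i w * arow (A w) i j 0 / l2norm (arow (A w) i) ^+ 2.
    by rewrite /= tuple_cv_row_tuple.
  rewrite -[RHS](integral_fresh_eq0 M km (measurable_obs_noise_row j) _ _ hC).
  + by apply: eq_integral => w _; rewrite phiE.
  + by move=> i; under eq_fun do rewrite phiE; exact: integrable_obs_noise_row.
  + by move=> i; under eq_integral do rewrite phiE; exact: (rn_noise_mean M).
- exact: (cv_measurable_step_error x0 solution).
- exact: integrable_error_noise_row.
Qed.

Lemma integrable_sqr_errorS :
  P.-integrable setT (EFin \o (fun w => l2norm (e k.+1 w) ^+ 2)).
Proof.
rewrite (_ : EFin \o _ = ((((EFin \o err) \-
    (fun w => (2 * alpha k - alpha k ^+ 2)%:E * (proj w)%:E)) \+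
    (fun w => (2 * alpha k * (1 - alpha k))%:E * (cross w)%:E)) \+
    (fun w => (alpha k ^+ 2)%:E * (noise w)%:E))%E); last first.
  apply/funext => w; rewrite /= (sqr_l2norm_step_error eps idx x0 solution).
  by rewrite -!EFinM -EFinB -!EFinD.
apply: integrableD => //; last exact/integrableZl/integrable_noise.
apply: integrableD => //; last exact/integrableZl/integrable_cross.
by apply: integrableB => //; exact/integrableZl/integrable_proj.
Qed.

Lemma integral_sqr_errorS :
  (\int[P]_w (l2norm (e k.+1 w) ^+ 2)%:E =
   \int[P]_w (err w)%:E
   - (2 * alpha k - alpha k ^+ 2)%:E * \int[P]_w (proj w)%:E
   + (alpha k ^+ 2 * sigma ^+ 2)%:E)%E.
Proof.
have ip : P.-integrable setT
    (fun w => (2 * alpha k - alpha k ^+ 2)%:E * (proj w)%:E)%E.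
  exact/integrableZl/integrable_proj.
have ic : P.-integrable setT
    (fun w => (2 * alpha k * (1 - alpha k))%:E * (cross w)%:E)%E.
  exact/integrableZl/integrable_cross.
have ino : P.-integrable setT (fun w => (alpha k ^+ 2)%:E * (noise w)%:E)%E.
  exact/integrableZl/integrable_noise.
transitivity (\int[P]_w ((((err w)%:E
    - (2 * alpha k - alpha k ^+ 2)%:E * (proj w)%:E)
    + (2 * alpha k * (1 - alpha k))%:E * (cross w)%:E)
    + (alpha k ^+ 2)%:E * (noise w)%:E))%E.
  apply: eq_integral => w _; rewrite (sqr_l2norm_step_error eps idx x0 solution).
  by rewrite -!EFinM -EFinB -!EFinD.
rewrite integralD//; last by apply: integrableD => //; exact: integrableB.
rewrite integralD//; last exact: integrableB.
rewrite integralB// !integralZl//; [|exact: integrable_noise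
  |exact: integrable_cross|exact: integrable_proj].
by rewrite integral_cross integral_noise mule0 adde0 EFinM.
Qed.

Lemma step_error_neq0 w : (xk k w != x) = (err w != 0).
Proof. by rewrite /err sqrf_eq0 l2norm_eq0 /step_error subr_eq0. Qed.

Let cosine w := `|dot (normalize (xk k w - x)) (normalize (a k w))| ^+ 2.

(** Weighting by the squared error cancels the normalisation of the direction. Both sides vanish
    where the error is 0, so the identity holds everywhere although alignment speaks only of nonzero
    errors. *)
Lemma sqr_error_cosine w : err w * cosine w = proj w.
Proof.
rewrite /cosine real_normK ?num_real// dot_normalize -/(e k w) (dotC (e k w)).
rewrite /err /proj; have [e0|e0] := eqVneq (l2norm (e k w)) 0.
  have /eqP E : e k w == 0 by rewrite -l2norm_eq0 e0.
  have -> : dot (a k w) (e k w) = 0.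
    by rewrite dotC E /dot big1// => j _; rewrite mxE mul0r.
  by rewrite e0 expr0n !mul0r.
rewrite exprMn exprVn exprMn invfM mulrCA; congr (_ * _).
by rewrite mulrA mulfV ?mul1r// sqrf_eq0.
Qed.

Lemma cosine_le1 w : cosine w <= 1.
Proof.
rewrite /cosine real_normK ?num_real// dot_normalize.
rewrite exprMn exprVn.
have := sqr_dot_le (xk k w - x) (a k w); rewrite -!sqr_l2norm -exprMn.
set c := l2norm _ * _; have [->|c0] := eqVneq c 0.
  by rewrite expr0n invr0 mulr0.
by move=> H; rewrite ler_pdivrMr ?exprn_even_gt0// mul1r.
Qed.

Lemma measurable_cosine : measurable_fun setT cosine.
Proof.
apply: measurable_funX; apply: measurableT_comp => //.
apply: measurable_dot; apply: cv_measurable_normalize.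
  exact: cv_measurable_step_errorT.
exact: cv_measurable_row.
Qed.

(** Alignment says that [1_D (cosine - eta)] integrates to 0 over every history event. Multiplying
    by the history-measurable squared error, which vanishes off [D], turns this variable into
    [proj - eta * err] on the whole space. *)
Lemma integral_proj (eta : R) : alignment A b eps idx x x0 eta alpha k ->
  (\int[P]_w (proj w)%:E = eta%:E * \int[P]_w (err w)%:E)%E.
Proof.
move=> aligned; pose D := [set w | xk k w != x].
have merrH : measurable_fun setT (err : H k -> R).
  apply: measurable_funX; apply: measurable_l2norm.
  exact: (cv_measurable_step_error x0 solution).
have hD : history A eps idx k D.
  have -> : D = setT `&` err @^-1` [set~ 0].
    rewrite setTI; apply/seteqP; split => w; rewrite /D/= step_error_neq0.
      by move/eqP.
    by move=> /eqP.
  by apply: (merrH measurableT); exact: measurableC.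
have mD : measurable D by exact: (history_measurable M (ltnW km)).
have icos : P.-integrable setT (EFin \o cosine).
  have i1 : P.-integrable setT (EFin \o cst 1).
    exact: finite_measure_integrable_cst.
  apply: le_integrable i1 => //.
    exact/measurable_EFinP/measurable_cosine.
  by move=> w _; rewrite /= lee_fin normr1 ger0_norm ?sqr_ge0// cosine_le1.
have ieta (S : set T) : measurable S -> P.-integrable S (EFin \o cst eta).
  by move=> mS; exact: finite_measure_integrable_cst.
have icoseta : P.-integrable setT (EFin \o (fun w => cosine w - eta)).
  rewrite (_ : _ \o _ = (EFin \o cosine) \- (EFin \o cst eta))%E//.
  by apply: integrableB => //; exact: ieta.
pose W w := \1_D w * (cosine w - eta).
have iW : P.-integrable setT (EFin \o W) by exact: integrable_indicM.
have W0 C : history A eps idx k C -> (\int[P]_(w in C) (W w)%:E = 0)%E.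
  move=> hC; have mC := history_measurable M (ltnW km) hC.
  have hCD : history A eps idx k (C `&` D).
    exact: (@measurableI _ (H k)).
  have mCD := measurableI _ _ mC mD.
  transitivity (\int[P]_(w in C `&` D) (cosine w - eta)%:E)%E.
    rewrite (integral_indicM P C) (integral_indicM P (C `&` D)).
    apply: eq_integral => w _; rewrite /W !indicE in_setI mulrA.
    by case: (w \in C); case: (w \in D); rewrite ?mul1r ?mul0r ?mulr1.
  under eq_integral do rewrite EFinB.
  rewrite (integralB_EFin mCD (integrableS measurableT mCD (@subsetT _ _) icos)
    (ieta _ mCD)).
  rewrite (aligned _ hCD (@subIsetr _ _ _)).
  have -> : (\int[P]_(w in C `&` D) (cst eta w)%:E = eta%:E * P (C `&` D))%E.
    exact: (integral_cst _ mCD eta%:E).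
  by rewrite subee// fin_numM// fin_num_measure.
have errW w : err w * W w = proj w - eta * err w.
  rewrite -sqr_error_cosine /W indicE.
  have [e0|e0] := eqVneq (err w) 0; first by rewrite e0; ring.
  by rewrite mem_set /D/= ?step_error_neq0//; ring.
have ieerr : P.-integrable setT (fun w => eta%:E * (err w)%:E)%E.
  exact: integrableZl.
have ierrW : P.-integrable setT (fun w => (err w * W w)%:E).
  under eq_fun do rewrite errW EFinB EFinM.
  by apply: integrableB => //; exact: integrable_proj.
have := integral_factor_eq0 (history_idfun_measurable (ltnW km)) iW W0 merrH
  ierrW.
under eq_integral do rewrite errW EFinB EFinM.
rewrite (integralB measurableT integrable_proj ieerr) integralZl//.
move=> /eqP; rewrite sube_eq ?add0e.
- by move/eqP.
- by rewrite (integrable_fin_num measurableT integrable_proj).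
- by apply: fin_num_adde_defr.
Qed.

End Step.

Lemma integrable_sqr_error k : (k <= m)%N ->
  P.-integrable setT (EFin \o (fun w => l2norm (e k w) ^+ 2)).
Proof.
elim: k => [|k IH] km; last exact/integrable_sqr_errorS/IH/ltnW.
rewrite (_ : _ \o _ = EFin \o cst (l2norm (x0 - x) ^+ 2))//.
exact: finite_measure_integrable_cst.
Qed.

Lemma expected_errorE k : expected_error A b eps idx x x0 alpha k =
  (\int[P]_w (l2norm (e k w) ^+ 2)%:E)%E.
Proof.
rewrite /expected_error unlock; apply: eq_integral => w _.
by rewrite -l2normN opprB.
Qed.

Lemma expected_errorS (eta delta : R) k : (k < m)%N ->
  alignment A b eps idx x x0 eta alpha k ->
  expected_error A b eps idx x x0 alpha k = delta%:E ->
  expected_error A b eps idx x x0 alpha k.+1 =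
    (delta - (2 * alpha k - alpha k ^+ 2) * (eta * delta)
     + alpha k ^+ 2 * sigma ^+ 2)%:E.
Proof.
move=> km aligned; rewrite !expected_errorE => E.
have ierr := integrable_sqr_error (ltnW km).
by rewrite (integral_sqr_errorS km ierr) (integral_proj km ierr aligned) E.
Qed.

End ErrorRecursion.

(** * The scalar recursion for the normalised error *)

Section ScalarRecursion.
Context {R : realType}.
Variables (eta beta0 : R).
Hypotheses (eta_ge0 : 0 <= eta) (eta_le1 : eta <= 1) (beta0_ge0 : 0 <= beta0).

Lemma opt_beta_ge0 k : 0 <= opt_beta eta beta0 k.
Proof.
elim: k => //= k IH; rewrite mulr_ge0// subr_ge0.
have eb : 0 <= eta * opt_beta eta beta0 k by rewrite mulr_ge0.
rewrite mulr_ile1//; first by rewrite divr_ge0// addr_ge0.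
by rewrite ler_pdivrMr ?mul1r ?lerDl// ltr_wpDl.
Qed.

Lemma opt_step_value (k : nat) :
  let beta := opt_beta eta beta0 k in
  let alpha := opt_alpha eta beta0 k in
  beta - (2 * alpha - alpha ^+ 2) * (eta * beta) + alpha ^+ 2 =
  opt_beta eta beta0 k.+1.
Proof.
move=> beta alpha; rewrite /alpha /opt_alpha/= -/beta.
have b0 : 0 <= beta by exact: opt_beta_ge0.
have : eta * beta + 1 != 0 by rewrite gt_eqF// ltr_wpDl// mulr_ge0.
by move=> h; field.
Qed.

Lemma opt_step_le (k : nat) (c beta' : R) : opt_beta eta beta0 k <= beta' ->
  opt_beta eta beta0 k.+1 <= beta' - (2 * c - c ^+ 2) * (eta * beta') + c ^+ 2.
Proof.
rewrite -opt_step_value; set beta := opt_beta _ _ k; set alpha := opt_alpha _ _ k.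
move=> bb'; have b0 : 0 <= beta by exact: opt_beta_ge0.
have D0 : 0 < eta * beta + 1 by rewrite ltr_wpDl// mulr_ge0.
have aE : alpha * (eta * beta + 1) = eta * beta.
  by rewrite /alpha /opt_alpha -/beta divfK// gt_eqF.
apply: (@le_trans _ _ (beta - (2 * c - c ^+ 2) * (eta * beta) + c ^+ 2)).
  (* First the rate changes at fixed [beta]: completing the square, the excess over the optimal rate
     is [(eta beta + 1) (c - alpha)^2]. *)
  rewrite -subr_ge0 (_ : _ - _ = (eta * beta + 1) * (c - alpha) ^+ 2).
    by rewrite mulr_ge0 ?sqr_ge0// ltW.
  transitivity ((eta * beta + 1) * (c ^+ 2 - alpha ^+ 2)
    - 2 * (c - alpha) * (alpha * (eta * beta + 1))); last by ring.
  by rewrite aE; ring.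
rewrite lerD2r -subr_ge0.
(* Then [beta] grows to [beta'] at fixed rate: the slope [1 - (2c - c^2) eta] equals
   [(1 - eta) + eta (1 - c)^2], which is nonnegative for every real [c]. *)
rewrite (_ : _ - _ = (beta' - beta) * ((1 - eta) + eta * (1 - c) ^+ 2));
  last by ring.
by rewrite mulr_ge0 ?subr_ge0// addr_ge0 ?subr_ge0// mulr_ge0 ?sqr_ge0.
Qed.

End ScalarRecursion.

(** * From the scalar recursion to optimal schedules *)

Section Optimality.
Context {R : realType} {d : measure_display} {T : measurableType d}.
Variables (P : probability T R) (m n : nat).
Variables (A : T -> 'M[R]_(m, n)) (b : T -> 'cV[R]_m)
  (eps : 'I_m -> {RV P >-> R}) (idx : nat -> T -> 'I_m) (x x0 : 'cV[R]_n)
  (sigma eta : R).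
Hypothesis sigma_gt0 : 0 < sigma.
Hypothesis solution : forall w, A w *m x = b w.
Hypothesis M : row_noise_model A eps idx sigma.

Let beta0 := l2norm (x - x0) ^+ 2 / sigma ^+ 2.
Local Notation beta := (opt_beta eta beta0).
Local Notation alpha := (opt_alpha eta beta0).
Local Notation error := (expected_error A b eps idx x x0).
Local Notation aligned := (alignment A b eps idx x x0 eta).

Let sigma2_neq0 : sigma ^+ 2 != 0.
Proof. by rewrite expf_neq0// gt_eqF. Qed.

Lemma expected_error0 alpha' : error alpha' 0 = (sigma ^+ 2 * beta0)%:E.
Proof.
rewrite /expected_error (_ : (fun _ => _) = cst (l2norm (x - x0) ^+ 2))//.
by rewrite expectation_cst /beta0 mulrC divfK.
Qed.

Lemma expected_error_ge0 alpha' k : (0 <= error alpha' k)%E.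
Proof. by apply: expectation_ge0 => w; exact: sqr_ge0. Qed.

(** At step 0 the error is a nonzero constant, so alignment can be tested on the sure event: there
    [eta] is the mean of a squared cosine. *)
Lemma alignment_bounds alpha' : x0 != x -> (0 < m)%N -> aligned alpha' 0 ->
  0 <= eta <= 1.
Proof.
move=> x0x m0 al.
have hT : history A eps idx 0 setT.
  exact: (@measurableT _ (g_sigma_algebraType (history_generators A eps idx 0))).
have := al setT hT (fun _ _ => x0x).
rewrite probability_setT mule1 => E.
rewrite -!lee_fin -E; apply/andP; split.
  by apply: integral_ge0 => w _; rewrite lee_fin sqr_ge0.
rewrite -[leRHS](integral_cst_probability P); apply: ge0_le_integral => //.
- apply/measurable_EFinP; exact: (measurable_cosine x0 solution M alpha' m0).
- exact/measurable_EFinP.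
- by move=> w _; rewrite lee_fin; exact: cosine_le1.
Qed.

(* If x0 = x, alignment is vacuous along the optimal schedule and leaves eta
   unconstrained, possibly negative, so this case is treated apart. *)
Lemma opt_beta_eq0 k : x0 = x -> beta k = 0.
Proof.
move=> x0x; elim: k => [|k IH] /=; last by rewrite IH mul0r.
by rewrite /beta0 x0x subrr (eqP (_ : l2norm 0 == 0)) ?l2norm_eq0// expr0n mul0r.
Qed.

Lemma iterate_opt_alpha_eq0 k w : x0 = x ->
  iterate A b eps idx alpha x0 k w = x0.
Proof.
move=> x0x; elim: k => //= k ->.
by rewrite /opt_alpha opt_beta_eq0// mulr0 !mul0r scale0r addr0.
Qed.

Lemma expected_error_opt : (forall k, (k < m)%N -> aligned alpha k) ->
  forall k, (k <= m)%N -> error alpha k = (sigma ^+ 2 * beta k)%:E.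
Proof.
move=> al; have [x0x|x0x] := eqVneq x0 x.
  move=> k _; rewrite opt_beta_eq0// mulr0.
  rewrite /expected_error (_ : (fun _ => _) = cst 0) ?expectation_cst//.
  apply/funext => w; rewrite iterate_opt_alpha_eq0// x0x subrr.
  by rewrite (eqP (_ : l2norm 0 == 0)) ?l2norm_eq0// expr0n.
elim=> [|k IH] km; first exact: expected_error0.
have m0 : (0 < m)%N by exact: leq_ltn_trans km.
have /andP[e0 e1] := alignment_bounds x0x m0 (al 0%N m0).
rewrite (expected_errorS solution M km (al k km) (IH (ltnW km))).
rewrite -opt_step_value//; last by rewrite divr_ge0 ?sqr_ge0.
by congr EFin; ring.
Qed.

Lemma expected_error_optimal : (forall k, (k < m)%N -> aligned alpha k) ->
  forall alpha' k, (k <= m)%N -> (forall j, (j < k)%N -> aligned alpha' j) ->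
  (error alpha k <= error alpha' k)%E.
Proof.
move=> al alpha' k km al'; rewrite expected_error_opt//.
have [x0x|x0x] := eqVneq x0 x.
  rewrite opt_beta_eq0// mulr0.
  exact: expected_error_ge0.
case: k km al' => [|k] km al'; first by rewrite expected_error0.
have m0 : (0 < m)%N by exact: leq_ltn_trans km.
have /andP[e0 e1] := alignment_bounds x0x m0 (al 0%N m0).
(* The invariant keeps the competitor's error as a real multiple of [sigma ^+ 2], so that its own
   alignment drives the same scalar recursion, and keeps it above the optimal value. *)
suff [beta' [-> H]] : exists beta', error alpha' k.+1 = (sigma ^+ 2 * beta')%:E /\
    beta k.+1 <= beta'.
  by rewrite lee_fin ler_wpM2l ?sqr_ge0.
elim: k.+1 km al' => [|l IH] lm al'.
  by exists beta0; rewrite expected_error0.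
have [j jl|beta' [E H]] := IH (ltnW lm).
  exact: (al' j (leqW jl)).
exists (beta' - (2 * alpha' l - alpha' l ^+ 2) * (eta * beta') + alpha' l ^+ 2).
split; last by apply: opt_step_le => //; rewrite divr_ge0 ?sqr_ge0.
rewrite (expected_errorS solution M lm (al' l (ltnSn l)) E).
by congr EFin; ring.
Qed.

End Optimality.

(** * The two sampling models *)

Section WithoutReplacement.
Context {R : realType} {d : measure_display} {T : measurableType d}.
Variables (P : probability T R) (m n : nat).
Variables (A : T -> 'M[R]_(m, n)) (eps : 'I_m -> {RV P >-> R})
  (idx : nat -> T -> 'I_m) (sigma : R) (A0 : 'M[R]_(m, n)).
Hypothesis W : without_replacement_model A eps idx sigma A0.

Lemma wr_integral_sqr_noise i : (\int[P]_w (eps i w ^+ 2)%:E =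
  (sigma ^+ 2 * l2norm (arow A0 i) ^+ 2)%:E)%E.
Proof.
rewrite -(wr_noise_variance W) /variance unlock (wr_noise_mean W)/=.
rewrite unlock; apply: eq_integral => w _.
by rewrite /= fctE /= subr0 -expr2.
Qed.

Lemma wr_integrable_noise i : P.-integrable setT (EFin \o eps i).
Proof.
apply: integrable_of_sqr => //; apply/integrableP; split.
  by apply/measurable_EFinP; exact: measurable_funX.
under eq_integral do rewrite gee0_abs ?lee_fin ?sqr_ge0//.
by rewrite wr_integral_sqr_noise ltry.
Qed.

(** A repeated index has sampling weight 0 at its second occurrence, which makes the whole path
    event null. *)
Lemma wr_path_inj (h : nat -> 'I_m) : P (path_event idx h m) != 0%E ->
  forall i j, (i < m)%N -> (j < m)%N -> h i = h j -> i = j.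
Proof.
move=> Ph.
have mpath k : (k <= m)%N -> measurable (path_event idx h k).
  move=> km.
  have -> : path_event idx h k = \bigcap_(j in `I_k) idx j @^-1` [set h j] by [].
  apply: fin_bigcap_measurable => [|j /= jk]; first exact: finite_II.
  by apply: (wr_idx_measurable W); exact: leq_trans km.
suff noteq i j : (i < j)%N -> (j < m)%N -> h i <> h j.
  move=> i j im jm hij; case: (ltngtP i j) => // [ij|ji].
    by case: (noteq _ _ ij jm).
  by case: (noteq _ _ ji im).
move=> ij jm hij; move/eqP: Ph; apply.
have E := wr_idx_law W h (h j) jm.
have w0 : weight_without_replacement A0 h j (h j) = 0.
  rewrite /weight_without_replacement ifT//; apply/imsetP.
  by exists (Ordinal ij) => //=; rewrite hij.
move: E; rewrite w0 mule0 => E.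
apply/eqP; rewrite eq_le measure_ge0 andbT -E.
apply: le_measure; rewrite ?inE//; first exact: mpath.
  by apply: measurableI; [exact/mpath/ltnW|exact: (wr_idx_measurable W)].
by move=> w /= Hw; split; [move=> l lj; apply: Hw; exact: ltn_trans jm|exact: Hw].
Qed.

Lemma row_noise_model_without_replacement : row_noise_model A eps idx sigma.
Proof.
have AE : A = cst A0 by apply/funext => w; exact: (wr_matrix W).
split.
- exact: (wr_idx_measurable W).
- by move=> i; rewrite AE; exact: (@measurable_cst _ _ _ _ _ (row_tuple A0 i)).
- move=> h B mB.
  (* The matrix is constant, so an event of the observation is a noise event, namely the section of
     [B i] at the fixed row. *)
  pose B' i := [set r | B i (row_tuple A0 i, r)].
  have mB' i : measurable (B' i).
    rewrite -[B' i]setTI; exact: (pair1_measurable (row_tuple A0 i)).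
  have obsE i : observation A eps i @^-1` B i = eps i @^-1` B' i.
    by rewrite AE.
  pose N := \bigcap_(i in [set: 'I_m]) ((fun t : m.-tuple R => tnth t i) @^-1` B' i).
  have mN : measurable N.
    apply: fin_bigcap_measurable => // i _.
    by rewrite -[X in measurable X]setTI; exact: measurable_tnth.
  have := wr_idx_noise_independent W h mN.
  rewrite (_ : [set w | N [tuple eps i w | i < m]] =
    [set w | forall i, B i (observation A eps i w)]); last first.
    apply/seteqP; split => w /= H i; first have := H i I.
      by rewrite /= tnth_mktuple /B'/= /observation AE.
    by move=> _ /=; rewrite tnth_mktuple; have := H i; rewrite /observation AE.
  move=> ->; congr (_ * _)%E.
  have := wr_noise_independent W [set: 'I_m]%SET mB'.
  rewrite (_ : \bigcap_(i in _) _ = [set w | forall i, B i (observation A eps i w)]).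
    move=> ->; apply: eq_big => [i|i _]; first by rewrite finset.in_setT.
    by rewrite obsE.
  apply/seteqP; split => w /= H i.
    by have := H i; rewrite /= finset.in_setT /observation AE; apply.
  by move=> _; have := H i; rewrite /observation AE.
- exact: wr_path_inj.
- move=> i j; rewrite AE.
  transitivity (\int[P]_w
      ((arow A0 i j 0 / l2norm (arow A0 i) ^+ 2)%:E * (eps i w)%:E))%E.
    by apply: eq_integral => w _; rewrite -EFinM; congr EFin => /=; ring.
  rewrite integralZl//; last exact: wr_integrable_noise.
  have := wr_noise_mean W i; rewrite unlock => ->.
  by rewrite mule0.
- move=> i; rewrite AE.
  transitivity (\int[P]_w
      ((l2norm (arow A0 i) ^+ 2)^-1%:E * (eps i w ^+ 2)%:E))%E.
    by apply: eq_integral => w _; rewrite -EFinM mulrC.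
  rewrite ge0_integralZl_EFin ?invr_ge0 ?sqr_ge0//.
  + rewrite wr_integral_sqr_noise -EFinM mulrCA mulVf ?mulr1//.
    by rewrite sqrf_eq0 l2norm_eq0 (wr_rows_neq0 W).
  + by move=> w _; rewrite lee_fin sqr_ge0.
  + by apply/measurable_EFinP; exact: measurable_funX.
Qed.

End WithoutReplacement.

(** * Random matrices with i.i.d. rows used in order *)

Section IidRows.
Context {R : realType} {d : measure_display} {T : measurableType d}.
Variables (P : probability T R) (m n : nat).
Variables (A : T -> 'M[R]_(m, n)) (eps : 'I_m -> {RV P >-> R})
  (idx : nat -> T -> 'I_m) (sigma : R).
Hypothesis W : iid_rows_model A eps idx sigma.

Lemma iid_row_measurable i : measurable_fun setT (fun w => row_tuple (A w) i).
Proof.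
apply/measurable_fun_tnthP => j.
rewrite (_ : _ \o _ = fun w => A w i j); first exact: (iid_matrix_measurable W).
by apply/funext => w; rewrite /= tnth_mktuple.
Qed.

Lemma measurable_row_event i B : measurable B ->
  measurable [set w | B (row_tuple (A w) i)].
Proof.
by move=> mB; rewrite -[X in measurable X]setTI; exact: iid_row_measurable.
Qed.

Lemma cv_measurable_iid_row i : cv_measurable (fun w => arow (A w) i).
Proof.
by move=> j; under eq_fun do rewrite !mxE; exact: (iid_matrix_measurable W).
Qed.

Lemma measurable_tuple_l2norm :
  measurable_fun setT (fun t : n.-tuple R => l2norm (tuple_cv t)).
Proof. exact: (measurable_l2norm (@cv_measurable_tuple_cv _ _)). Qed.

Lemma measurable_tuple_ball (r : R) :
  measurable [set t : n.-tuple R | l2norm (tuple_cv t) <= r].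
Proof.
rewrite (_ : [set t | _] =
  setT `&` (fun t : n.-tuple R => l2norm (tuple_cv t)) @^-1` `]-oo, r]).
  exact: measurable_tuple_l2norm.
by rewrite setTI; apply/seteqP; split => t /=; rewrite in_itv.
Qed.

Lemma measurable_row_eq0 i : measurable [set w | arow (A w) i = 0].
Proof.
rewrite (_ : [set w | _] = (fun w => l2norm (arow (A w) i)) @^-1` [set 0]).
  rewrite -[X in measurable X]setTI.
  by apply: (measurable_l2norm (cv_measurable_iid_row i)).
apply/seteqP; split => w /= => [->|]; first by apply/eqP; rewrite l2norm_eq0.
by move/eqP; rewrite l2norm_eq0 => /eqP.
Qed.

(** The variance condition compares [eps^2] with [sigma^2 |a|^2] on events of the row; both are
    multiplied by [1 / |a|^2], a function of the row, and the second product is [sigma^2] almost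
    surely since rows are almost surely nonzero. *)
Lemma iid_noise_variance_normalized i : (\int[P]_w
  (eps i w ^+ 2 / l2norm (arow (A w) i) ^+ 2)%:E = (sigma ^+ 2)%:E)%E.
Proof.
pose f (t : n.-tuple R) := (l2norm (tuple_cv t) ^+ 2)^-1.
have mf : measurable_fun setT f.
  by apply: measurable_funV; apply: measurable_funX; exact: measurable_tuple_l2norm.
have mN : measurable_fun setT (fun w => l2norm (arow (A w) i) ^+ 2).
  by apply: measurable_funX; apply: measurable_l2norm; exact: cv_measurable_iid_row.
have fE w : f (row_tuple (A w) i) = (l2norm (arow (A w) i) ^+ 2)^-1.
  by rewrite /f tuple_cv_row_tuple.
transitivity (\int[P]_w (f (row_tuple (A w) i) * eps i w ^+ 2)%:E)%E.
  by apply: eq_integral => w _; rewrite fE mulrC.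
rewrite (ge0_integral_factor_eq (iid_row_measurable i)
  (V := fun w => sigma ^+ 2 * l2norm (arow (A w) i) ^+ 2))//.
- transitivity (\int[P]_w (cst (sigma ^+ 2) w)%:E)%E; last first.
    exact: integral_cst_probability.
  apply: ae_eq_integral => //.
  + apply/measurable_EFinP; apply: measurable_funM; last exact: measurable_funM.
    exact: (measurableT_comp mf (iid_row_measurable i)).
  + exact/measurable_EFinP.
  + exists [set w | arow (A w) i = 0]; split.
    * exact: measurable_row_eq0.
    * exact: (iid_rows_neq0 W).
    * move=> w /=; apply: contra_notP => /eqP a0 _.
      by rewrite fE mulrCA mulVf ?mulr1// sqrf_eq0 l2norm_eq0.
- exact: measurable_funX.
- by move=> w; exact: sqr_ge0.
- exact: measurable_funM.
- by move=> w; rewrite mulr_ge0 ?sqr_ge0.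
- by move=> C mC; exact: (iid_noise_variance W i mC).
- by move=> t; rewrite invr_ge0 sqr_ge0.
Qed.

Lemma iid_integrable_noise_row i j : P.-integrable setT
  (fun w => (eps i w * arow (A w) i j 0 / l2norm (arow (A w) i) ^+ 2)%:E).
Proof.
apply: integrable_noise_mul_coord => //; first exact: cv_measurable_iid_row.
apply/integrableP; split.
  apply/measurable_EFinP; apply: measurable_funM; first exact: measurable_funX.
  apply: measurable_funV; apply: measurable_funX.
  by apply: measurable_l2norm; exact: cv_measurable_iid_row.
under eq_integral do rewrite gee0_abs ?lee_fin ?divr_ge0 ?sqr_ge0//.
by rewrite iid_noise_variance_normalized ltry.
Qed.

(** On this event the variance condition bounds the second moment of the noise by [sigma^2 r^2],
    which makes the conditional mean testable there. *)
Lemma iid_integrable_noise_truncated i (r : R) : P.-integrable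
  [set w | l2norm (tuple_cv (row_tuple (A w) i)) <= r] (EFin \o eps i).
Proof.
set S := [set w | _].
have mB := measurable_tuple_ball r.
have mS : measurable S by exact: (measurable_row_event i mB).
have isq : P.-integrable S (fun w => (eps i w ^+ 2)%:E).
  apply/integrableP; split.
    by apply/measurable_EFinP; apply: measurable_funX; exact: measurable_funTS.
  under eq_integral do rewrite gee0_abs ?lee_fin ?sqr_ge0//.
  rewrite (iid_noise_variance W i mB).
  apply: (@le_lt_trans _ _ (\int[P]_(w in S) (cst (sigma ^+ 2 * r ^+ 2) w)%:E)%E).
    apply: ge0_le_integral => //.
    + by move=> w _; rewrite lee_fin mulr_ge0 ?sqr_ge0.
    + apply/measurable_EFinP; apply: measurable_funM => //.
      apply: measurable_funX; apply: measurable_funTS.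
      exact: measurable_l2norm (cv_measurable_iid_row i).
    + exact/measurable_EFinP.
    + move=> w; rewrite /S /= tuple_cv_row_tuple => Sw.
      rewrite lee_fin ler_wpM2l ?sqr_ge0// ler_pXn2r// nnegrE ?l2norm_ge0//.
      exact: le_trans (l2norm_ge0 _) Sw.
  have -> : (\int[P]_(w in S) (cst (sigma ^+ 2 * r ^+ 2) w)%:E =
      (sigma ^+ 2 * r ^+ 2)%:E * P S)%E.
    exact: (integral_cst _ mS (sigma ^+ 2 * r ^+ 2)%:E).
  by rewrite ltey_eq fin_numM// fin_num_measure.
by apply: integrable_of_sqr => //; exact: measurable_funTS.
Qed.

(* The noise itself need not be integrable: the mean is computed on the events
   |a_i| <= N, and eps_i a_ij / |a_i|^2, which is integrable, lets N tend to
   infinity by dominated convergence. *)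
Lemma iid_noise_mean_normalized i j : (\int[P]_w
  (eps i w * arow (A w) i j 0 / l2norm (arow (A w) i) ^+ 2)%:E = 0)%E.
Proof.
pose w_ w := eps i w * arow (A w) i j 0 / l2norm (arow (A w) i) ^+ 2.
pose B (N : nat) := [set t : n.-tuple R | l2norm (tuple_cv t) <= N%:R].
pose S N := [set w | B N (row_tuple (A w) i)].
have mB N : measurable (B N) by exact: measurable_tuple_ball.
have mS N : measurable (S N) by exact: (measurable_row_event i (mB N)).
have iw := iid_integrable_noise_row i j.
have mw : measurable_fun setT w_ by exact/measurable_EFinP/(measurable_int _ iw).
have trunc0 N : (\int[P]_w (\1_(S N) w * w_ w)%:E = 0)%E.
  pose f (t : n.-tuple R) := tuple_cv t j 0 / l2norm (tuple_cv t) ^+ 2.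
  have mf : measurable_fun setT f.
    apply: measurable_funM; first exact: cv_measurable_tuple_cv.
    by apply: measurable_funV; apply: measurable_funX; exact: measurable_tuple_l2norm.
  (* The truncated noise is integrable and centred on every event of the row; the remaining factor
     [a_ij / |a_i|^2] depends on the row alone. *)
  pose V w := \1_(S N) w * eps i w.
  have fV w : \1_(S N) w * w_ w = f (row_tuple (A w) i) * V w.
    by rewrite /w_ /f /V tuple_cv_row_tuple; ring.
  have iV : P.-integrable setT (EFin \o V).
    have iS : P.-integrable (S N) (EFin \o eps i).
      exact: iid_integrable_noise_truncated.
    move/(integrable_mkcond _ (mS N)): iS; apply: eq_integrable => // w _.
    by rewrite /V patchE /= indicE; case: (w \in S N); rewrite ?mul1r ?mul0r.
  pose Z w := row_tuple (A w) i.
  have mZ : measurable_fun setT Z by exact: iid_row_measurable.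
  have V0 C : measurable C -> (\int[P]_(w in Z @^-1` C) (V w)%:E = 0)%E.
    move=> mC; have mZC := measurable_row_event i mC.
    have mCB : measurable (C `&` B N) by exact: measurableI.
    have iCB : P.-integrable [set w | (C `&` B N) (row_tuple (A w) i)]
        (fun w => (eps i w)%:E).
      apply: integrableS (iid_integrable_noise_truncated i N%:R).
      + exact: (mS N).
      + exact: (measurable_row_event i mCB).
      + by move=> w [].
    rewrite -[RHS](iid_noise_mean W mCB iCB).
    rewrite (_ : [set w | _] = Z @^-1` C `&` S N)//.
    rewrite (integral_indicM P (Z @^-1` C) V).
    rewrite (integral_indicM P (Z @^-1` C `&` S N) (eps i)).
    apply: eq_integral => w _.
    rewrite /V !indicE in_setI mulrA.
    by case: (w \in Z @^-1` C); case: (w \in S N); rewrite ?mul1r ?mul0r.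
  have iZV : P.-integrable setT (fun w => (f (Z w) * V w)%:E).
    by under eq_fun do rewrite -fV; exact: (integrable_indicM (mS N) iw).
  have := integral_factor_eq0 mZ iV V0 mf iZV.
  by under eq_integral do rewrite -fV.
have cvg_w : (\int[P]_w (\1_(S N) w * w_ w)%:E @[N --> \oo] -->
              \int[P]_w (w_ w)%:E)%E.
  (* Pointwise the sequence is eventually constant, as soon as [N] exceeds the norm of the row;
     [|w_|] dominates it. *)
  apply: (@dominated_cvg _ _ _ _ _ measurableT _ _ (fun w => `|(w_ w)%:E|%E)) => //.
  - by move=> N; apply/measurable_EFinP; apply: measurable_funM.
  - move=> w _; apply: cvg_near_cst; near=> N.
    rewrite indicE mem_set ?mul1r// /S /B /=.
    by near: N; exact: nbhs_infty_ger.
  - exact: integrable_abse iw.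
  - move=> N w _; rewrite !abse_EFin lee_fin normrM indicE.
    by case: (w \in _); rewrite ?normr1 ?normr0 ?mul1r ?mul0r.
have <- := cvg_lim (@ereal_hausdorff R) cvg_w.
by under eq_fun do rewrite trunc0; rewrite lim_cst.
Unshelve. all: by end_near.
Qed.

(** Rows are read in order, so a path event is the whole space when [h] is the identity below [m]
    and empty otherwise; conditioning on the path is then trivial. *)
Lemma row_noise_model_iid : row_noise_model A eps idx sigma.
Proof.
have pathE (h : nat -> 'I_m) : (forall j, (j < m)%N -> h j = j :> nat) ->
    path_event idx h m = setT.
  move=> hE; apply/seteqP; split => // w _ j jm.
  by apply/val_inj; rewrite /= (iid_in_order W) ?hE.
have path0 (h : nat -> 'I_m) : ~ (forall j, (j < m)%N -> h j = j :> nat) ->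
    path_event idx h m = set0.
  move=> hE; rewrite -subset0 => w Hw; apply: hE => j jm.
  by rewrite -(Hw j jm) (iid_in_order W).
split.
- move=> k i km; have [ki|ki] := eqVneq k i.
    rewrite (_ : _ @^-1` _ = setT)//; apply/seteqP; split => // w _.
    by apply/val_inj; rewrite /= (iid_in_order W).
  rewrite (_ : _ @^-1` _ = set0)//; rewrite -subset0 => w /= E.
  by move/eqP: ki; apply; rewrite -E (iid_in_order W).
- exact: iid_row_measurable.
- move=> h B mB; have [hE|hE] := pselect (forall j, (j < m)%N -> h j = j :> nat).
    rewrite pathE// setTI probability_setT mul1e.
    have := iid_independent W [set: 'I_m]%SET mB.
    rewrite (_ : \bigcap_(i in _) _ = [set w | forall i, B i (observation A eps i w)]).
      by move=> ->; apply: eq_big => [i|i _]; rewrite ?finset.in_setT.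
    apply/seteqP; split => w /= H i; first by have := H i; rewrite /= finset.in_setT; apply.
    by move=> _; exact: H.
  by rewrite path0// set0I measure0 mul0e.
- move=> h; have [hE _ i j im jm hij|hE] := pselect (forall j, (j < m)%N -> h j = j :> nat).
    by rewrite -(hE i im) -(hE j jm) hij.
  by rewrite path0// measure0 eqxx.
- exact: iid_noise_mean_normalized.
- exact: iid_noise_variance_normalized.
Qed.

End IidRows.

(** * Alignment for i.i.d. rows *)

Section IsotropicRows.
Context {R : realType} {d : measure_display} {T : measurableType d}.
Variables (P : probability T R) (n : nat) (v : T -> 'cV[R]_n).
Hypothesis mv : cv_measurable v.
Hypothesis v_unit : (\int[P]_w (l2norm (v w) ^+ 2)%:E = 1)%E.
Hypothesis v_le1 : forall w, l2norm (v w) <= 1.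
Hypothesis isotropic : forall z : 'cV[R]_n,
  ((n%:R^-1 * l2norm z ^+ 2)%:E <= 'E_P[fun w => (`|dot z (v w)| ^+ 2)%R])%E.

Lemma norm_coord_le1 (u : 'cV[R]_n) i : l2norm u <= 1 -> `|u i 0| <= 1.
Proof.
move=> u1; rewrite -(@ler_pXn2r _ 2)// ?nnegrE// expr1n real_normK ?num_real//.
by apply: (le_trans (sqr_coord_le _ _)); rewrite expr_le1// l2norm_ge0.
Qed.

Lemma integrable_coord_mul i j :
  P.-integrable setT (EFin \o (fun w => v w i 0 * v w j 0)).
Proof.
have i1 : P.-integrable setT (EFin \o cst 1).
  exact: finite_measure_integrable_cst.
apply: le_integrable i1 => //.
  by apply/measurable_EFinP; apply: measurable_funM; exact: mv.
move=> w _; rewrite /= lee_fin normr1 normrM.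
by rewrite -[leRHS]mulr1 ler_pM ?norm_coord_le1.
Qed.

Let C i j := fine (\int[P]_w (v w i 0 * v w j 0)%:E)%E.

Lemma coord_mulE i j : (\int[P]_w (v w i 0 * v w j 0)%:E = (C i j)%:E)%E.
Proof.
rewrite fineK//; exact: (integrable_fin_num measurableT (integrable_coord_mul i j)).
Qed.

Lemma dot_delta (u : 'cV[R]_n) i : dot (delta_mx i 0) u = u i 0.
Proof.
rewrite /dot (bigD1 i)//= big1 ?addr0 ?mxE ?eqxx ?mul1r// => l li.
by rewrite mxE (negbTE li) mul0r.
Qed.

Lemma second_moment_diag_ge i : n%:R^-1 <= C i i.
Proof.
have := isotropic (delta_mx i 0).
rewrite sqr_l2norm dot_delta mxE !eqxx mulr1 unlock -lee_fin -coord_mulE.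
congr (_ <= _)%E; apply: eq_integral => w _.
by rewrite dot_delta real_normK ?num_real// expr2.
Qed.

(** The diagonal entries sum to the mean squared norm 1, and each of the [n] entries is at least
    [1/n], so none can exceed it. *)
Lemma second_moment_diag i : C i i = n%:R^-1.
Proof.
have tr : \sum_i C i i = 1.
  apply: EFin_inj; rewrite -sumEFin -v_unit.
  transitivity (\int[P]_w (\sum_i (v w i 0 * v w i 0)%:E))%E; last first.
    by apply: eq_integral => w _; rewrite sumEFin sqr_l2norm.
  rewrite integral_sum//; last by move=> j; exact: integrable_coord_mul.
  by apply: eq_bigr => j _; rewrite coord_mulE.
have n0 : (n%:R : R) != 0.
  by rewrite pnatr_eq0 -lt0n; exact: leq_ltn_trans (ltn_ord i).
have sum0 : \sum_i (C i i - n%:R^-1) = 0.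
  by rewrite sumrB tr sumr_const card_ord -[X in _ - X]mulr_natl mulfV// subrr.
apply/eqP; rewrite -subr_eq0; apply/eqP.
by apply: (psumr_eq0P _ sum0) => // j _; rewrite subr_ge0 second_moment_diag_ge.
Qed.

(* Polarisation along e_i +- e_j: the diagonal being exact, the inequality
   leaves no room for the off-diagonal term. *)
Lemma second_moment_offdiag i j : i != j -> C i j = 0.
Proof.
move=> ij.
have main (s : R) : s ^+ 2 = 1 -> 0 <= s * C i j.
  move=> s1; pose z : 'cV[R]_n := delta_mx i 0 + s *: delta_mx j 0.
  have zE u : dot z u = u i 0 + s * u j 0 by rewrite dotDl dotZl !dot_delta.
  have zz : l2norm z ^+ 2 = 2.
    rewrite sqr_l2norm zE !mxE !eqxx (negbTE ij) eq_sym (negbTE ij)/=.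
    by rewrite mulr0 addr0 add0r mulr1 -expr2 s1.
  have := isotropic z; rewrite zz unlock.
  have -> : (\int[P]_w (`|dot z (v w)| ^+ 2)%:E =
     ((C i i + C j j) + 2 * s * C i j)%:E)%E.
    transitivity (\int[P]_w (((v w i 0 * v w i 0)%:E + (v w j 0 * v w j 0)%:E)
        + (2 * s)%:E * (v w i 0 * v w j 0)%:E))%E.
      apply: eq_integral => w _; rewrite zE real_normK ?num_real//.
      rewrite -EFinM -!EFinD; congr EFin.
      transitivity (v w i 0 * v w i 0 + s ^+ 2 * (v w j 0 * v w j 0)
        + 2 * s * (v w i 0 * v w j 0)); first by ring.
      by rewrite s1 mul1r.
    have iM k l := integrable_coord_mul k l.
    have iMD := integrableD measurableT (iM i i) (iM j j).
    rewrite (integralD measurableT iMD (integrableZl measurableT _ (iM i j))).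
    rewrite (integralD measurableT (iM i i) (iM j j)).
    by rewrite (integralZl measurableT (iM i j)) !coord_mulE.
  rewrite lee_fin !second_moment_diag -mulrA.
  by set r := n%:R^-1; set q := s * C i j; lra.
have p1 := main 1 (expr1n _ _).
have p2 := main (-1) (etrans (sqrrN 1) (expr1n _ _)).
by apply/eqP; rewrite eq_le; apply/andP; split; lra.
Qed.

Lemma second_moment i j : (\int[P]_w (v w i 0 * v w j 0)%:E =
  ((i == j)%:R / n%:R)%:E)%E.
Proof.
rewrite coord_mulE; have [<-|ij] := eqVneq i j.
  by rewrite second_moment_diag mul1r.
by rewrite second_moment_offdiag// mul0r.
Qed.

End IsotropicRows.

(** * Alignment deduced from isotropy *)

Section IidAlignment.
Context {R : realType} {d : measure_display} {T : measurableType d}.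
Variables (P : probability T R) (m n : nat).
Variables (A : T -> 'M[R]_(m, n)) (b : T -> 'cV[R]_m)
  (eps : 'I_m -> {RV P >-> R}) (idx : nat -> T -> 'I_m) (x x0 : 'cV[R]_n)
  (sigma : R).
Hypothesis solution : forall w, A w *m x = b w.
Hypothesis W : iid_rows_model A eps idx sigma.
Hypothesis isotropic : forall (i : 'I_m) (z : 'cV[R]_n),
  ((n%:R^-1 * l2norm z ^+ 2)%:E <=
   'E_P[fun w => (`|dot z (normalize (arow (A w) i))| ^+ 2)%R])%E.

Let M := row_noise_model_iid W.
Local Notation obs := (observation A eps).
Local Notation H k := (g_sigma_algebraType (history_generators A eps idx k)).

Lemma sqr_l2norm_normalize (u : 'cV[R]_n) :
  l2norm (normalize u) ^+ 2 = (u != 0)%:R.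
Proof.
rewrite sqr_l2norm dotZl dotC dotZl -sqr_l2norm -(l2norm_eq0 u).
have [->|u0] := eqVneq (l2norm u) 0; first by rewrite expr0n !mulr0.
by rewrite expr2 mulKf// mulVf.
Qed.

Lemma l2norm_normalize_le1 (u : 'cV[R]_n) : l2norm (normalize u) <= 1.
Proof.
rewrite -(@ler_pXn2r _ 2)// ?nnegrE ?l2norm_ge0// expr1n sqr_l2norm_normalize.
by case: (u != 0).
Qed.

Lemma cv_measurable_normalized_row i :
  cv_measurable (fun w => normalize (arow (A w) i)).
Proof. exact/cv_measurable_normalize/(cv_measurable_iid_row W). Qed.

Lemma normalized_row_unit i :
  (\int[P]_w (l2norm (normalize (arow (A w) i)) ^+ 2)%:E = 1)%E.
Proof.
rewrite -[RHS](integral_cst_probability P); apply: ae_eq_integral => //.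
- apply/measurable_EFinP; apply: measurable_funX; apply: measurable_l2norm.
  exact: cv_measurable_normalized_row.
- exact/measurable_EFinP.
- exists [set w | arow (A w) i = 0]; split.
  + exact: (measurable_row_eq0 W).
  + exact: (iid_rows_neq0 W).
  + move=> w /=; apply: contra_notP => /eqP a0 _.
    by rewrite sqr_l2norm_normalize a0.
Qed.

(** Entry [(i, j)] of [v v^T - I/n] for the normalised row [v]: the second moments in centred form,
    ready for [integral_fresh_eq0]. *)
Let phi i j (y : n.-tuple R * R) :=
  normalize (tuple_cv y.1) i 0 * normalize (tuple_cv y.1) j 0
  - (i == j)%:R / n%:R.

Let phiE i j l w : phi i j (obs l w) =
  normalize (arow (A w) l) i 0 * normalize (arow (A w) l) j 0
  - (i == j)%:R / n%:R.
Proof. by rewrite /phi/= tuple_cv_row_tuple. Qed.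

Let mphi i j : measurable_fun setT (phi i j).
Proof.
have mt := cv_measurable_normalize (@cv_measurable_tuple_cv R n).
apply: measurable_funB => //; apply: measurable_funM.
  exact: (measurableT_comp (mt i) measurable_fst).
exact: (measurableT_comp (mt j) measurable_fst).
Qed.

Let integrable_phi i j l : P.-integrable setT (fun w => (phi i j (obs l w))%:E).
Proof.
under eq_fun do rewrite phiE EFinB.
apply: integrableB => //.
  apply: integrable_coord_mul; first exact: cv_measurable_normalized_row.
  by move=> w; exact: l2norm_normalize_le1.
exact: finite_measure_integrable_cst.
Qed.

Let integral_phi i j l : (\int[P]_w (phi i j (obs l w))%:E = 0)%E.
Proof.
pose c : R := (i == j)%:R / n%:R.
have ic : P.-integrable setT (EFin \o cst c).
  exact: finite_measure_integrable_cst.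
under eq_integral do rewrite phiE EFinB.
have mv := cv_measurable_normalized_row l.
have v1 w : l2norm (normalize (arow (A w) l)) <= 1.
  exact: l2norm_normalize_le1.
rewrite (integralB_EFin measurableT (integrable_coord_mul P mv v1 i j) ic).
rewrite integral_cst_probability.
rewrite (second_moment mv (normalized_row_unit l) v1 (isotropic l)).
by rewrite subee.
Qed.

(** The squared cosine expands into [sum u_i u_j v_i v_j], where the direction [u] of the error is
    bounded and history-measurable and [v] is the fresh normalised row. Replacing [v_i v_j] by its
    mean leaves [|u|^2 / n]. *)
Lemma alignment_iid (alpha : nat -> R) k : (k < m)%N ->
  alignment A b eps idx x x0 n%:R^-1 alpha k.
Proof.
move=> km S hS SD.
have mS := history_measurable M (ltnW km) hS.
pose u w := normalize (iterate A b eps idx alpha x0 k w - x).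
pose v w := normalize (arow (A w) (idx k w)).
have muH : cv_measurable (u : H k -> 'cV[R]_n).
  apply: cv_measurable_normalize.
  exact: (cv_measurable_step_error x0 solution).
pose f (p : 'I_n * 'I_n) (w : H k) := \1_S w * (u w p.1 0 * u w p.2 0).
have mf p : measurable_fun setT (f p).
  apply: measurable_funM; first exact: (@measurable_indic _ (H k)).
  by apply: measurable_funM; exact: muH.
have ifresh p := integrable_fresh M km (mphi p.1 p.2) (integrable_phi p.1 p.2).
have f1 p w : `|f p w| <= 1.
  rewrite /f !normrM indicE -[leRHS]mulr1 ler_pM ?mulr_ge0//.
    by case: (w \in S); rewrite ?normr1 ?normr0.
  by rewrite -[leRHS]mulr1 ler_pM// norm_coord_le1// l2norm_normalize_le1.
have ifphi p : P.-integrable setT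
    (fun w => (f p w * phi p.1 p.2 (obs (idx k w) w))%:E).
  apply: le_integrable (ifresh p) => //.
    apply/measurable_EFinP; apply: measurable_funM.
      exact: (history_measurable_fun M (ltnW km)).
    exact/measurable_EFinP/(measurable_int _ (ifresh p)).
  by move=> w _; rewrite /= lee_fin normrM ler_piMl.
have fphi0 p : (\int[P]_w (f p w * phi p.1 p.2 (obs (idx k w) w))%:E = 0)%E.
  apply: (integral_factor_eq0 (history_idfun_measurable M (ltnW km)) (f := f p)).
  - exact: ifresh.
  - move=> C hC; exact: (integral_fresh_eq0 M km).
  - exact: mf.
  - exact: ifphi.
rewrite (integral_indicM P S (fun w => `|dot (u w) (v w)| ^+ 2)).
transitivity (\int[P]_w (\sum_(p : 'I_n * 'I_n)
    (f p w * phi p.1 p.2 (obs (idx k w) w))%:E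
    + (n%:R^-1)%:E * (\1_S w)%:E))%E.
  apply: eq_integral => w _; rewrite sumEFin -EFinM -EFinD; congr EFin.
  rewrite indicE; have [wS|wS] := boolP (w \in S); last first.
    rewrite mul0r mulr0 addr0 big1// => p _.
    by rewrite /f indicE (negbTE wS) !mul0r.
  (* On [S] the error is nonzero, so its direction is a genuine unit vector and the diagonal
     correction sums to exactly [1/n]. *)
  have u1 : dot (u w) (u w) = 1.
    rewrite -sqr_l2norm sqr_l2norm_normalize subr_eq0.
    by move: wS; rewrite inE => /SD /= ->.
  rewrite mul1r mulr1 real_normK ?num_real//.
  under eq_bigr => p _ do rewrite /f indicE wS mul1r phiE mulrBr.
  rewrite big_split/= sumrN.
  have -> : \sum_(p : 'I_n * 'I_n) u w p.1 0 * u w p.2 0 * (v w p.1 0 * v w p.2 0)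
      = dot (u w) (v w) ^+ 2.
    rewrite expr2 /dot big_distrlr/= pair_big/=.
    by apply: eq_bigr => p _; ring.
  have -> : \sum_(p : 'I_n * 'I_n) u w p.1 0 * u w p.2 0 * ((p.1 == p.2)%:R / n%:R)
      = n%:R^-1.
    rewrite -(pair_big xpredT xpredT (fun i j => u w i 0 * u w j 0 *
      ((i == j)%:R / n%:R)))/= -[RHS]mulr1.
    rewrite -[X in _ = _ * X]u1 mulr_sumr.
    apply: eq_bigr => i _; rewrite (bigD1 i)//= eqxx big1 ?addr0; first by rewrite mul1r mulrC.
    by move=> j ji; rewrite eq_sym (negbTE ji) mul0r mulr0.
  by rewrite subrK.
have i1 : P.-integrable setT (fun w => (\1_S w)%:E) by exact: integrable_indic.
rewrite integralD//; [|exact: integrable_sum|exact: integrableZl].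
rewrite integralZl// integral_indic// setIT integral_sum//.
by rewrite big1 ?add0e// => p _; exact: fphi0.
Qed.

End IidAlignment.

Theorem corollary1p4 (R : realType) (d : measure_display)
    (T : measurableType d) (P : probability T R) (m n : nat)
    (A : T -> 'M[R]_(m, n)) (b : T -> 'cV[R]_m) (x x0 : 'cV[R]_n)
    (eps : 'I_m -> {RV P >-> R}) (idx : nat -> T -> 'I_m) (sigma eta : R)
    (sigma_gt0 : 0 < sigma)
    (solution : forall w, A w *m x = b w) :
  let beta0 := l2norm (x - x0) ^+ 2 / sigma ^+ 2 in
  let beta := opt_beta eta beta0 in
  let alpha := opt_alpha eta beta0 in
  let error := expected_error A b eps idx x x0 in
  let aligned := alignment A b eps idx x x0 eta in
  ((exists A0, without_replacement_model A eps idx sigma A0) \/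
     iid_rows_model A eps idx sigma ->
   (forall k, (k < m)%N -> aligned alpha k) ->
   (forall k, (k <= m)%N -> error alpha k = (sigma ^+ 2 * beta k)%:E) /\
   (forall (alpha' : nat -> R) k, (k <= m)%N ->
      (forall j, (j < k)%N -> aligned alpha' j) ->
      (error alpha k <= error alpha' k)%E))
  /\
  (iid_rows_model A eps idx sigma ->
   eta = n%:R^-1 ->
   (forall (i : 'I_m) (z : 'cV[R]_n),
      ((eta * l2norm z ^+ 2)%:E <=
       'E_P[fun w => (`|dot z (normalize (arow (A w) i))| ^+ 2)%R])%E) ->
   (forall (alpha' : nat -> R) k, (k < m)%N -> aligned alpha' k) /\
   (forall k, (k <= m)%N -> error alpha k = (sigma ^+ 2 * beta k)%:E) /\
   (forall (alpha' : nat -> R) k, (k <= m)%N ->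
      (error alpha k <= error alpha' k)%E)).
Proof.
move=> beta0 beta alpha error aligned; split.
  move=> model al.
  have M : row_noise_model A eps idx sigma.
    case: model => [[A0 W]|W]; first exact: row_noise_model_without_replacement W.
    exact: row_noise_model_iid.
  split; first exact: (expected_error_opt sigma_gt0 solution M).
  exact: (expected_error_optimal sigma_gt0 solution M).
move=> W etaE isotropic; have M := row_noise_model_iid W.
(* Alignment now holds along every schedule, so the comparison with competitors needs no condition
   on them. *)
have al alpha' k : (k < m)%N -> aligned alpha' k.
  move=> km; rewrite /aligned etaE.
  by apply: (alignment_iid solution W) => // i z; rewrite -etaE.
split=> //; split.
  by apply: (expected_error_opt sigma_gt0 solution M) => k; exact: al.
move=> alpha' k km.
apply: (expected_error_optimal sigma_gt0 solution M) => // j jk; apply: al => //.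
exact: leq_trans jk km.
Qed.
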